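(* Let $K,M\in\mathbb{N}$, let $P>0$ be a power constraint, let $f:\mathcal S_1\times\dots\times\mathcal S_K\to\mathbb R$ belong to $\mathcal F_{\mathrm{mon}}$ and let $\Phi$ be an increment majorant of $f$. Consider the $M$-use channel with fading and noise correlated as determined by matrices $A\in\mathbb R^{2KM\times(2KM+2M)}$ and $B\in\mathbb R^{2M\times(2KM+2M)}$. Let $A_i\in\mathbb R^{2KM\times(2KM+2M)}$ be a matrix which generates user-uncorrelated fading and approximates $A$ in the sense that $$\|(A+A_i)(A-A_i)^T\|\le\eta .$$ Then there exist pre- and post-processing operations (an admissible DFA scheme with $M$ channel uses) whose resulting estimate $\bar f$ satisfies, for all $(s_1,\dots,s_K)\in\mathcal S_1\times\dots\times\mathcal S_K$ and all $\varepsilon>0$ in the range of $\Phi$, $$\mathbb P\big(|\bar f-f(s_1,\dots,s_K)|\ge\varepsilon\big)\le 2\exp\Big(-\frac{M\Phi^{-1}(\varepsilon)^2}{16F+D+4\Phi^{-1}(\varepsilon)L}\Big)+2\exp\Big(-\frac{M\Phi^{-1}(\varepsilon)^2}{256F+32\Phi^{-1}(\varepsilon)L}\Big),$$ where $$L=\Big(\sqrt{\bar\Delta(f)}\,\|A\|+\sqrt{\tfrac{\Delta(f)}{P}}\,\|B\|\Big)^2,$$ $$F=L\Big(\sqrt{\tfrac{\bar\Delta(f)}{M}}\,\|A\|_F+\sqrt{\tfrac{\Delta(f)}{PM}}\,\|B\|_F\Big)^2,$$ $$D=\Big(4\sqrt{2M}\,\bar\Delta(f)\,\eta+4\tfrac{\Delta(f)}{\sqrt{PM}}\,\|AB^T\|_F\Big)^2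 .$$
   Context: $\|\cdot\|$ and $\|\cdot\|_F$ are the operator and Frobenius norms of matrices. Sub-Gaussian norm: for a real random variable $X$, $\tau(X):=\inf\{t>0:\forall\lambda\in\mathbb R,\ \mathbb E\exp(\lambda(X-\mathbb EX))\le\exp(\lambda^2t^2/2)\}$; $X$ is sub-Gaussian if $\tau(X)<\infty$. Function class: $\mathcal S_1,\dots,\mathcal S_K\subseteq\mathbb R$ are closed, with Borel $\sigma$-algebras. A measurable $f:\mathcal S_1\times\dots\times\mathcal S_K\to\mathbb R$ belongs to $\mathcal F_{\mathrm{mon}}$ if there are bounded measurable $f_k:\mathcal S_k\to\mathbb R$, a measurable $D_0\subseteq\mathbb R$ with $f_1(\mathcal S_1)+\dots+f_K(\mathcal S_K)\subseteq D_0$, a measurable $F_0:D_0\to\mathbb R$ with $f(s_1,\dots,s_K)=F_0(\sum_{k=1}^Kf_k(s_k))$ for all $(s_1,\dots,s_K)$, and a strictly increasing $\Phi:[0,\infty)\to[0,\infty)$ with $\Phi(0)=0$ and $|F_0(x)-F_0(y)|\le\Phi(|x-y|)$ for all $x,y\in D_0$. Such a $\Phi$ is called an increment majorant of $f$. A representation of $f$ is fixed, and with $\phi_{\min,k}:=\inf_{s\in\mathcal S_k}f_k(s)$, $\phi_{\max,k}:=\sup_{s\in\mathcal S_k}f_k(s)$ one sets $\bar\Delta(f):=\sum_{k=1}^K(\phi_{\max,k}-\phi_{\min,k})$ and $\Delta(f):=\max_{1\le k\le K}(\phi_{\max,k}-\phi_{\min,k})$. Channel: for $m=1,\dots,M$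 the output is $Y(m)=\sum_{k=1}^KH_k(m)x_k(m)+N(m)$, with inputs $x_k(m)\in\mathbb C$, $|x_k(m)|^2\le P$. The complex random variables $H_k(m)=H_k^r(m)+iH_k^i(m)$ have sub-Gaussian real and imaginary parts with mean $0$ and variance $1$; $N(m)=N^r(m)+iN^i(m)$ has sub-Gaussian real and imaginary parts with mean $0$. Put $H:=(H(1),\dots,H(2M))^T\in\mathbb R^{2KM}$ with blocks $H(2m-1):=(H_1^r(m),\dots,H_K^r(m))$, $H(2m):=(H_1^i(m),\dots,H_K^i(m))$, and $N:=(N^r(1),N^i(1),\dots,N^r(M),N^i(M))^T\in\mathbb R^{2M}$. Fading and noise are ''correlated as determined by $A$ and $B$'' if there is a random vector $R$ with $2KM+2M$ independent real entries, each of sub-Gaussian norm at most $1$, such that $H=AR$ and $N=BR$. User-uncorrelated: a matrix $A_i\in\mathbb R^{2KM\times(2KM+2M)}$, split vertically into $2M$ consecutive blocks $A_i^{(1)},\dots,A_i^{(2M)}\in\mathbb R^{K\times(2KM+2M)}$, generates user-uncorrelated fading if each block $A_i^{(m)}$ has at most one nonzero entry per column. Admissible DFA scheme with $M$ channel uses: encoders $E_k^M(s_k)=(E_k(m,s_k,U_k(m)))_{m=1}^M\in\mathbb C^M$, $k=1,\dots,K$, where the $U_k(m)$ are random variables, jointly independent of $(H,N)$, the map $(s_k,t_1,\dots,t_M)\mapsto(E_k(m,s_k,t_m))_{m=1}^M$ is measurable, and $|E_k(m,s_k,U_k(m))|^2\le P$; together with a measurable decoder $D^M:\mathbb C^M\to\mathbb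 R$. The resulting estimate is $D^M(Y(1),\dots,Y(M))$ when $x_k(m)=E_k(m,s_k,U_k(m))$. *)

(* Defs.v *)
From HB Require Import structures.
From mathcomp Require Export all_boot all_order all_algebra.
From mathcomp Require Export complex.
From mathcomp Require Export all_classical all_reals all_analysis.

Set Implicit Arguments.
Unset Strict Implicit.
Unset Printing Implicit Defensive.

Import Order.TTheory GRing.Theory Num.Theory.
Import numFieldNormedType.Exports.

Local Open Scope classical_set_scope.
Local Open Scope ring_scope.

(* Borel sigma-algebra of C = R x R: all preimages of measurable subsets of
   R * R under z |-> (Re z, Im z). *)
Definition complex_display : measure_display. Proof. exact: default_measure_display. Qed.

Section measurable_complex.
Context {R : realType}.

Definition complex_measurable : set (set R[i]) :=
  preimage_set_system setT (fun z : R[i] => (complex.Re z, complex.Im z))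
    measurable.

Let complex_sigma_algebra : sigma_algebra setT complex_measurable.
Proof.
apply: sigma_algebra_preimage; split; first exact: measurable0.
- by move=> A mA; rewrite setTD; exact: measurableC.
- exact: bigcupT_measurable.
Qed.

Let complex_measurable0 : complex_measurable set0.
Proof. by case: complex_sigma_algebra. Qed.

Let complex_measurableC A :
  complex_measurable A -> complex_measurable (~` A).
Proof. by case: complex_sigma_algebra => _ + _ mA => /(_ _ mA); rewrite setTD. Qed.

Let complex_measurable_bigcup (F : (set R[i])^nat) :
  (forall i, complex_measurable (F i)) -> complex_measurable (\bigcup_i F i).
Proof. by case: complex_sigma_algebra => _ _; exact. Qed.

HB.instance Definition _ := isPointed.Build R[i] 0.
HB.instance Definition _ := @isMeasurable.Build complex_display R[i]
  complex_measurable complex_measurable0 complex_measurableC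
  complex_measurable_bigcup.

End measurable_complex.

Section matrix_norms.
Context {R : realType}.

Definition frobenius_norm m n (A : 'M[R]_(m, n)) : R :=
  Num.sqrt (\sum_i \sum_j A i j ^+ 2).

Definition euclidean_norm n (x : 'cV[R]_n) : R :=
  Num.sqrt (\sum_i x i 0 ^+ 2).

(* The library's norm on matrices is the entrywise maximum, not this one. *)
Definition operator_norm m n (A : 'M[R]_(m, n)) : R :=
  sup [set euclidean_norm (A *m x) | x in
         [set x : 'cV[R]_n | euclidean_norm x <= 1]].

End matrix_norms.

Section random_variables.
Context d (T : measurableType d) (R : realType) (Pr : probability T R).
Local Open Scope ereal_scope.

Definition subgaussian_norm (X : T -> R) : \bar R :=
  ereal_inf [set t%:E | t in
    [set t : R | (0 < t)%R /\ forall lambda : R,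
       'E_Pr[fun w => expR (lambda * (X w - fine 'E_Pr[X]))]
         <= (expR (lambda ^+ 2 * t ^+ 2 / 2))%:E]].

Definition subgaussian (X : T -> R) : Prop := subgaussian_norm X < +oo.

(* Product rule over all indices; taking B i = setT for the others gives it for
   every subfamily. *)
Definition mutually_independent n (X : 'I_n -> T -> R) : Prop :=
  forall B : 'I_n -> set R, (forall i, measurable (B i)) ->
    Pr (\bigcap_i (X i @^-1` B i)) = \prod_(i < n) Pr (X i @^-1` B i).

End random_variables.

Section function_class.
Context {R : realType} {K : nat}.

Definition box (S : 'I_K -> set R) : set (K.-tuple R) :=
  [set s | forall k, S k (tnth s k)].

Record mon_representation (S : 'I_K -> set R) (f : K.-tuple R -> R)
    (fk : 'I_K -> R -> R) (D0 : set R) (F0 : R -> R) : Prop := {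
  mon_measurable : measurable_fun (box S) f ;
  mon_inner_measurable : forall k, measurable_fun (S k) (fk k) ;
  mon_inner_bounded : forall k, [bounded fk k x | x in S k] ;
  mon_domain_measurable : measurable D0 ;
  mon_domain_sub :
    [set \sum_(k < K) fk k (tnth s k) | s in box S] `<=` D0 ;
  mon_outer_measurable : measurable_fun D0 F0 ;
  mon_repr : forall s, box S s -> f s = F0 (\sum_(k < K) fk k (tnth s k)) }.

(* Only the restriction of Phi to [0, +oo[ matters. *)
Record increment_majorant (D0 : set R) (F0 : R -> R) (Phi : R -> R) : Prop := {
  majorant_ge0 : forall x, 0 <= x -> 0 <= Phi x ;
  majorant_incr : forall x y, 0 <= x -> x < y -> Phi x < Phi y ;
  majorant0 : Phi 0 = 0 ;
  majorant_le : forall x y, D0 x -> D0 y -> `|F0 x - F0 y| <= Phi `|x - y| }.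

Definition majorant_inv (Phi : R -> R) : R -> R := pinv [set x : R | 0 <= x] Phi.

Definition spread (S : 'I_K -> set R) (fk : 'I_K -> R -> R) (k : 'I_K) : R :=
  sup (fk k @` S k) - inf (fk k @` S k).

Definition total_spread S fk : R := \sum_(k < K) spread S fk k.

(* The default 0 is harmless: spreads over nonempty sets are nonnegative. *)
Definition max_spread S fk : R := \big[Num.max/0]_(k < K) spread S fk k.

End function_class.

Section channel.
Context {R : realType} {K M : nat}.

Lemma half_ord_subproof (b : 'I_(2 * M)) : (b./2 < M)%N.
Proof. by rewrite ltn_half_double -mul2n. Qed.

(* Position b of the 2M real coordinates is, counting from 0, the real (b even)
   or imaginary (b odd) part of channel use b./2. *)
Definition half_ord (b : 'I_(2 * M)) : 'I_M := Ordinal (half_ord_subproof b).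

Definition real_coord (z : 'I_M -> R[i]) (b : 'I_(2 * M)) : R :=
  if odd b then complex.Im (z (half_ord b)) else complex.Re (z (half_ord b)).

Definition noise_vector (n : 'I_M -> R[i]) : 'cV[R]_(2 * M) :=
  \col_b real_coord n b.

(* Row-major stacking of the 2M blocks of length K; coordinate k of block b has
   index [mxvec_index b k]. *)
Definition fading_vector (h : 'I_K -> 'I_M -> R[i]) : 'cV[R]_(2 * M * K) :=
  (mxvec (\matrix_(b < 2 * M, k < K) real_coord (h k) b))^T.

Definition user_uncorrelated n (A : 'M[R]_(2 * M * K, n)) : Prop :=
  forall (b : 'I_(2 * M)) (j : 'I_n) (k k' : 'I_K),
    A (mxvec_index b k) j != 0 -> A (mxvec_index b k') j != 0 -> k = k'.

Definition channel_output (h : 'I_K -> 'I_M -> R[i]) (n : 'I_M -> R[i])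
    (x : 'I_K -> 'I_M -> R[i]) : M.-tuple R[i] :=
  [tuple \sum_(k < K) h k m * x k m + n m | m < M].

Context d (T : measurableType d) (Pr : probability T R).

Record fading_channel (H : 'I_K -> 'I_M -> {RV Pr >-> R[i]})
    (N : 'I_M -> {RV Pr >-> R[i]}) : Prop := {
  fading_subgaussian_Re : forall k m,
    subgaussian Pr (fun w => complex.Re (H k m w)) ;
  fading_subgaussian_Im : forall k m,
    subgaussian Pr (fun w => complex.Im (H k m w)) ;
  fading_mean_Re : forall k m,
    ('E_Pr[fun w => complex.Re (H k m w)] = 0)%E ;
  fading_mean_Im : forall k m,
    ('E_Pr[fun w => complex.Im (H k m w)] = 0)%E ;
  fading_variance_Re : forall k m,
    ('V_Pr[fun w => complex.Re (H k m w)] = 1)%E ;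
  fading_variance_Im : forall k m,
    ('V_Pr[fun w => complex.Im (H k m w)] = 1)%E ;
  noise_subgaussian_Re : forall m,
    subgaussian Pr (fun w => complex.Re (N m w)) ;
  noise_subgaussian_Im : forall m,
    subgaussian Pr (fun w => complex.Im (N m w)) ;
  noise_mean_Re : forall m, ('E_Pr[fun w => complex.Re (N m w)] = 0)%E ;
  noise_mean_Im : forall m, ('E_Pr[fun w => complex.Im (N m w)] = 0)%E }.

Definition correlated_as (A : 'M[R]_(2 * M * K, 2 * M * K + 2 * M))
    (B : 'M[R]_(2 * M, 2 * M * K + 2 * M))
    (H : 'I_K -> 'I_M -> {RV Pr >-> R[i]})
    (N : 'I_M -> {RV Pr >-> R[i]}) : Prop :=
  exists X : 'I_(2 * M * K + 2 * M) -> {RV Pr >-> R},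
    [/\ mutually_independent Pr X,
        forall i, (subgaussian_norm Pr (X i) <= 1)%E,
        forall w, fading_vector (fun k m => H k m w) = A *m \col_i X i w &
        forall w, noise_vector (fun m => N m w) = B *m \col_i X i w].

End channel.

(* The randomness U of the encoders comes with its own probability space; in
   [scheme_estimate] the experiment lives on the product of the channel's space
   with it, so that the family (U k m)_{k, m} is independent of (H, N). *)
Record dfa_scheme (R : realType) (K M : nat) (S : 'I_K -> set R) (P : R) := {
  rnd_display : measure_display ;
  rnd_space : measurableType rnd_display ;
  rnd_law : probability rnd_space R ;
  rnd : 'I_K -> 'I_M -> {RV rnd_law >-> R} ;
  enc : 'I_K -> 'I_M -> R -> R -> R[i] ;
  dec : M.-tuple R[i] -> R ;
  enc_measurable : forall k,
    measurable_fun (S k `*` [set: M.-tuple R])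
      (fun p => [tuple enc k m p.1 (tnth p.2 m) | m < M]) ;
  enc_power : forall k m s u,
    S k s -> `|enc k m s (rnd k m u)| ^+ 2 <= real_complex R P ;
  dec_measurable : measurable_fun setT dec }.

Definition scheme_estimate (R : realType) (K M : nat) (S : 'I_K -> set R)
    (P : R) (sch : dfa_scheme M S P) (T : Type)
    (H : 'I_K -> 'I_M -> T -> R[i]) (N : 'I_M -> T -> R[i]) (s : K.-tuple R)
    (w : T * rnd_space sch) : R :=
  dec sch (channel_output (fun k m => H k m w.1) (fun m => N m w.1)
             (fun k m => enc sch k m (tnth s k) (rnd sch k m w.2))).

(* Main.v *)
(** Every user sends a random sign times the square root of its normalised value
    f_k(s_k) - inf f_k, and the receiver reads the sum of the f_k(s_k) off the
    received energy. In the centred driving vector Y the rescaled energy is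
    |V Y|^2, where the matrix V depends on the signs, has operator norm at most
    sqrt L and squared Frobenius norm at most M F / L.

    Given the signs, a Hanson-Wright bound controls |V Y|^2 minus its conditional
    mean; it is proved by integrating out one coordinate of Y after the other.
    The conditional mean is a sum over channel uses of independent terms in
    [0, 16 L / 3], hence has a Bernstein type moment bound. Together,
    log E exp (l (|V Y|^2 - mean)) <= 64 l^2 M F for |l| <= 1 / (16 L), and the
    Chernoff bound yields the second exponential of the theorem alone, even at
    half the deviation that is needed. The spare factor 2 pays for extending F_0
    from D_0 to the real line. *)
Require Import Defs.
From HB Require Import structures.
From mathcomp Require Import all_boot all_order all_algebra.
From mathcomp Require Import complex.
From mathcomp Require Import all_classical all_reals all_analysis.
From mathcomp Require Import measurable_realfun ring lra.

Set Implicit Arguments.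
Unset Strict Implicit.
Unset Printing Implicit Defensive.

Import Order.TTheory GRing.Theory Num.Theory.
Import numFieldNormedType.Exports.

Local Open Scope classical_set_scope.
Local Open Scope ring_scope.

(** The fading of different users and the noise may be correlated, so the mean received energy
    contains cross terms foreign to the sum to be computed. Signs independent of the channel remove
    them exactly on average. As the fading has unit variance, what is left after rescaling is
    [2 * M] times the sum of the normalised values plus a noise energy fixed by the law of the
    channel. The price is a conditional mean that varies with the signs and needs its own
    concentration bound.

    A rotation destroys the independence of non-Gaussian entries, so the form cannot simply be
    diagonalised. The induction over coordinates rests instead on the bound [1/8] on the form being
    inherited by the rank one update.

    Constants: sub-Gaussian norm at most 1 gives E exp(3/8 X^2) <= 2 for centred X. Hence second
    moments are at most 8/3, and the log-moment of a centred square at parameter a is at most 20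
    a^2. In units of l^2 times [L * g], Hanson-Wright contributes 40 and the varying mean
    (16/3)(8/3) < 24, which explains 64. *)

Section exponential_bounds.
Context {R : realType}.
Implicit Types x y : R.

(** * Elementary bounds for the exponential *)

Lemma expRB1_norm_le y : `|expR y - 1| <= `|y| * expR `|y|.
Proof.
have e1 := expR_ge1Dx y; have e2 := expR_ge1Dx (- y).
have e3 := expR_gt0 y.
have e4 : expR (- y) * expR y = 1 by rewrite -expRD addNr expR0.
have [y0|y0] := leP 0 y.
  rewrite !ger0_norm//; last by rewrite subr_ge0 -expR0 ler_expR.
  nra.
rewrite (ltr0_norm y0) distrC ger0_norm; last first.
  by rewrite subr_ge0 -expR0 ler_expR ltW.
have : 1 <= expR (- y) by rewrite -expR0 ler_expR; lra.
nra.
Qed.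

(* The doubling identity e^(2h) - 1 - 2h = (e^h - 1)^2 + 2 (e^h - 1 - h) turns
   a constant c into 1/4 + c/2; two rounds from c = 1 give 5/8. *)
Lemma expR_le_quadratic y : expR y <= 1 + y + 5 / 8 * y ^+ 2 * expR `|y|.
Proof.
have base (z : R) : expR z - 1 - z <= z ^+ 2 * expR `|z|.
  have := expRB1_norm_le z.
  have e2 := expR_ge1Dx (- z).
  have e3 := expR_gt0 z.
  have e4 : expR (- z) * expR z = 1 by rewrite -expRD addNr expR0.
  have H : expR z - 1 - z <= z * (expR z - 1) by nra.
  move=> Hn; apply: (le_trans H); apply: (le_trans (ler_norm _)).
  by rewrite normrM -real_normK ?num_real// expr2 -mulrA ler_wpM2l.
have double (c : R) : 0 <= c ->
    (forall z : R, expR z - 1 - z <= c * z ^+ 2 * expR `|z|) ->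
    forall z : R, expR z - 1 - z <= (4^-1 + c / 2) * z ^+ 2 * expR `|z|.
  move=> c0 Hc z.
  have zE : z = z / 2 + z / 2 by lra.
  set h := z / 2 in zE.
  have nzE : `|z| = `|h| + `|h| by rewrite zE -mulr2n normrMn mulr2n.
  rewrite nzE zE !expRD.
  have := Hc h.
  have := expRB1_norm_le h.
  have e1 : 1 <= expR `|h| by rewrite -expR0 ler_expR.
  have : `|expR h - 1| ^+ 2 = (expR h - 1) ^+ 2 by rewrite real_normK ?num_real.
  have : `|h| ^+ 2 = h ^+ 2 by rewrite real_normK ?num_real.
  move: (expR h) (expR `|h|) e1 (normr_ge0 h) (normr_ge0 (expR h - 1)) => E F F1.
  move: `|E - 1| `|h| => p q q0 p0 qE pE pq Hh.
  have sq : (E - 1) ^+ 2 <= h ^+ 2 * (F * F).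
    rewrite -pE -qE.
    have : p ^+ 2 <= (q * F) ^+ 2 by rewrite lerXn2r ?nnegrE// mulr_ge0//; lra.
    by rewrite exprMn; nra.
  have FF : c * h ^+ 2 * F <= c * h ^+ 2 * (F * F).
    rewrite ler_wpM2l//; first by rewrite mulr_ge0// sqr_ge0.
    nra.
  nra.
have H1 (z : R) : expR z - 1 - z <= 1 * z ^+ 2 * expR `|z| by rewrite mul1r.
have H2 := double _ ler01 H1.
have c0 : 0 <= (4^-1 + 1 / 2 : R) by lra.
have := double _ c0 H2 y; lra.
Qed.

(** Squaring [1 + x/4 <= expR (x/4)] and using [(x/4 - 1)^2 >= 0] gives [x <= expR (x/2)]; a second
    squaring finishes. *)
Lemma sqr_le_expR x : 0 <= x -> x ^+ 2 <= expR x.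
Proof.
move=> x0; have H := expR_ge1Dx (x / 4).
have -> : x = x / 4 + x / 4 + (x / 4 + x / 4) by lra.
rewrite !expRD; move: (expR (x / 4)) H => E H.
have H2 : (1 + x / 4) * (1 + x / 4) <= E * E by rewrite ler_pM//; lra.
have H3 : x <= E * E by have := sqr_ge0 (x / 4 - 1); lra.
have -> : x / 4 + x / 4 + (x / 4 + x / 4) = x by lra.
by rewrite expr2 ler_pM.
Qed.

(** The range is chosen for [expR (3/8) <= 1 / (1 - 3/8) = 8/5], which cancels the constant 5/8. *)
Lemma expR_le_quadratic1 y : `|y| <= 3 / 8 -> expR y <= 1 + y + y ^+ 2.
Proof.
move=> y1; apply: (le_trans (expR_le_quadratic y)).
have : expR `|y| <= 8 / 5.
  apply: (@le_trans _ _ (expR (3 / 8))); first by rewrite ler_expR.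
  have := expR_ge1Dx (- (3 / 8 : R)); have := expR_gt0 (3 / 8 : R).
  have : expR (- (3 / 8)) * expR (3 / 8) = 1 :> R by rewrite -expRD addNr expR0.
  nra.
have := sqr_ge0 y; nra.
Qed.

End exponential_bounds.

(** * Exponential moments of squares of sub-Gaussian variables *)

Lemma tonelli_le d1 d2 (T1 : measurableType d1) (T2 : measurableType d2)
    (R : realType) (m1 : {sigma_finite_measure set T1 -> \bar R})
    (m2 : {sigma_finite_measure set T2 -> \bar R})
    (f : T1 * T2 -> \bar R) (h : T2 -> \bar R) :
  measurable_fun setT f -> (forall x, 0 <= f x)%E -> measurable_fun setT h ->
  (forall y, \int[m1]_x f (x, y) <= h y)%E ->
  (\int[m1]_x \int[m2]_y f (x, y) <= \int[m2]_y h y)%E.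
Proof.
move=> mf f0 mh fh; rewrite (fubini_tonelli f)//; apply: ge0_le_integral => //.
- by move=> y _; apply: integral_ge0.
- exact: (measurable_fun_fubini_tonelli_G f mf f0).
Qed.

Section subgaussian_square.
Context d (T : measurableType d) (R : realType) (Pr : probability T R).
Local Open Scope ereal_scope.

Definition mgf_subgaussian (X : T -> R) := forall l : R,
  \int[Pr]_w (expR (l * X w))%:E <= (expR (l ^+ 2 / 2))%:E.

(** The norm is an infimum, so only some [t] with [t^2 <= 1 + e'] is available; [e'] is chosen with
    [e' * l^2 / 2 <= e], and then [e] tends to 0. The case [e = 1] already excludes an infinite
    integral. *)
Lemma subgaussian_norm_mgf (X : {RV Pr >-> R}) : subgaussian_norm Pr X <= 1 ->
  mgf_subgaussian (fun w => X w - fine 'E_Pr[X])%R.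
Proof.
move=> X1 l.
have I0 : 0 <= \int[Pr]_w (expR (l * (X w - fine 'E_Pr[X])))%:E.
  by apply: integral_ge0 => w _; rewrite lee_fin expR_ge0.
have Hd (e : R) : (0 < e)%R ->
    \int[Pr]_w (expR (l * (X w - fine 'E_Pr[X])))%:E
      <= (expR (l ^+ 2 / 2 + e))%:E.
  move=> e0; set e' := (2 * e / (l ^+ 2 + 1))%R.
  have l1 : (0 < l ^+ 2 + 1)%R by have := sqr_ge0 l; lra.
  have e'0 : (0 < e')%R by rewrite divr_gt0// mulr_gt0.
  set s := Num.sqrt (1 + e').
  have s1 : (1 < s)%R.
    by rewrite -(ltr_pXn2r (ltn0Sn 1)) ?nnegrE ?sqrtr_ge0// expr1n sqr_sqrtr; lra.
  have sE : (s ^+ 2 = 1 + e')%R by rewrite sqr_sqrtr; lra.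
  have : subgaussian_norm Pr X < s%:E.
    by apply: (le_lt_trans X1); rewrite lte_fin.
  move=> /ereal_inf_lt[_ [t [t0 Ht] <-]]; rewrite lte_fin => ts.
  move: (Ht l); rewrite unlock => /le_trans; apply.
  rewrite lee_fin ler_expR.
  have : (t ^+ 2 <= 1 + e')%R by rewrite -sE lerXn2r ?nnegrE ?ltW// (lt_trans t0).
  have : (e' * (l ^+ 2 + 1) = 2 * e)%R by rewrite /e' divfK// gt_eqF.
  have := sqr_ge0 l; nra.
move: I0 Hd; case: (\int[Pr]_w _) => [r|_ /(_ _ ltr01)|]//.
rewrite lee_fin le_eqVlt => /predU1P[<- _|r0 Hd]; first by rewrite lee_fin expR_ge0.
rewrite lee_fin -[r]lnK ?posrE// ler_expR; apply/ler_addgt0Pr => e e0.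
by rewrite -ler_expR lnK ?posrE// -lee_fin Hd.
Qed.

Context (X : {RV Pr >-> R}) (X_mgf : mgf_subgaussian X).

(* Writing exp (3/8 r^2) as a Gaussian average of exp (s g r) with s^2 = 3/4
   replaces the square in the exponent by a linear term. *)
Lemma mgf_subgaussian_expR_sqr :
  \int[Pr]_w (expR (3 / 8 * X w ^+ 2))%:E <= 2%:E.
Proof.
pose s : R := Num.sqrt (3 / 4).
have s2 : (s ^+ 2 = 3 / 4)%R by rewrite sqr_sqrtr; lra.
have n1 : (1 != 0 :> R)%R by rewrite oner_eq0.
have n2 : (2 != 0 :> R)%R by rewrite pnatr_eq0.
pose q : R := normal_peak (1 : R).
have q0 : (0 <= q)%R by exact: normal_peak_ge0.
pose g (p : T * measurableTypeR R) :=
  (q * expR (s * X p.1 * p.2 - p.2 ^+ 2 / 2))%:E.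
have -> : \int[Pr]_w (expR (3 / 8 * X w ^+ 2))%:E =
    \int[Pr]_w \int[lebesgue_measure]_x g (w, x).
  apply: eq_integral => w _.
  rewrite (_ : (fun x => g (w, x)) = fun x =>
     (expR (3 / 8 * X w ^+ 2))%:E * (normal_pdf (s * X w) 1 x)%:E).
    rewrite ge0_integralZl//; last 2 first.
    - by apply/measurable_EFinP; exact: measurable_normal_pdf.
    - by move=> x _; rewrite lee_fin normal_pdf_ge0.
    - by rewrite integral_normal_pdf mule1.
  apply/funext => x; rewrite /g/= normal_pdfE//= /normal_fun -EFinM.
  rewrite -/q mulrCA -expRD; congr (_ * expR _)%:E.
  rewrite expr1n; have -> : (1 *+ 2 = 2 :> R)%R by [].
  have : (3 / 8 * X w ^+ 2 = (s * X w) ^+ 2 / 2)%R by rewrite exprMn s2; lra.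
  by move=> ->; field.
(* The moment bound at [s * x] turns the weight exp(-x^2/2) into exp(-x^2/8), which is twice the
   normal density of standard deviation 2 when the peak is kept: hence the bound 2. *)
apply: (@le_trans _ _ (\int[lebesgue_measure]_x (2%:E * (normal_pdf 0 2 x)%:E))).
  apply: (@tonelli_le _ _ T (measurableTypeR R) R Pr lebesgue_measure g).
  - apply/measurable_EFinP; apply: measurable_funM => //.
    apply: measurableT_comp => //; apply: measurable_funB.
      apply: measurable_funM => //; apply: measurable_funM => //.
      exact: measurableT_comp.
    apply: measurable_funM => //; exact: measurable_funX.
  - by move=> p; rewrite lee_fin mulr_ge0// expR_ge0.
  - apply: emeasurable_funM => //.
    by apply/measurable_EFinP; exact: measurable_normal_pdf.
  move=> x.
  rewrite (_ : (fun w => g (w, x)) = fun w =>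
      (q * expR (- (x ^+ 2 / 2)))%:E * (expR ((s * x) * X w))%:E); last first.
    apply/funext => w; rewrite /g/= -EFinM -(mulrA q) -expRD.
    by congr (_ * expR _)%:E; ring.
  rewrite ge0_integralZl//; last 2 first.
  - apply/measurable_EFinP; apply: measurableT_comp => //.
    exact: measurable_funM.
  - by rewrite lee_fin mulr_ge0// expR_ge0.
  - apply: le_trans.
      by apply: lee_wpmul2l; [rewrite lee_fin mulr_ge0// expR_ge0|exact: X_mgf].
    rewrite -!EFinM lee_fin -(mulrA q) -expRD normal_pdfE//= mulrA.
    rewrite le_eqVlt; apply/predU1P; left; congr (_ * _)%R.
      rewrite /q /normal_peak expr1n mul1r.
      rewrite -mulrnAr.
      rewrite sqrtrM ?sqr_ge0// sqrtr_sqr ger0_norm// invfM mulrA divff// mul1r//.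
    congr expR; rewrite exprMn s2 subr0.
    have -> : (2 ^+ 2 *+ 2 = 8 :> R)%R by rewrite -mulr_natr; lra.
    lra.
rewrite ge0_integralZl//; last 2 first.
- by apply/measurable_EFinP; exact: measurable_normal_pdf.
- by move=> x _; rewrite lee_fin normal_pdf_ge0.
- by rewrite integral_normal_pdf mule1.
Qed.

Let measurable_sqr : measurable_fun setT (fun w => X w ^+ 2)%R.
Proof. exact: measurable_funX. Qed.

Let measurable_expR_sqr a : measurable_fun setT (fun w => expR (a * X w ^+ 2))%R.
Proof. by apply: measurableT_comp => //; exact: measurable_funM. Qed.

Lemma integrable_expR_sqr :
  Pr.-integrable setT (fun w => (expR (3 / 8 * X w ^+ 2))%:E).
Proof.
apply/integrableP; split; first by apply/measurable_EFinP.
under eq_integral do rewrite /= ger0_norm ?expR_ge0//.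
by rewrite (le_lt_trans mgf_subgaussian_expR_sqr)// ltry.
Qed.

Lemma integrable_sqr : Pr.-integrable setT (fun w => (X w ^+ 2)%:E).
Proof.
apply: (le_integrable measurableT _ _
  (integrableZl measurableT (8 / 3)%R integrable_expR_sqr)) => //.
  by apply/measurable_EFinP.
move=> w _; rewrite -EFinM !abse_EFin lee_fin ger0_norm ?sqr_ge0//.
rewrite ger0_norm; last by rewrite mulr_ge0 ?expR_ge0//; lra.
have := expR_ge1Dx (3 / 8 * X w ^+ 2); lra.
Qed.

Definition second_moment : R := fine (\int[Pr]_w (X w ^+ 2)%:E).

Lemma second_momentE : \int[Pr]_w (X w ^+ 2)%:E = second_moment%:E.
Proof. by rewrite fineK// (integrable_fin_num _ integrable_sqr). Qed.

Lemma second_moment_ge0 : (0 <= second_moment)%R.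
Proof. by rewrite fine_ge0// integral_ge0// => w _; rewrite lee_fin sqr_ge0. Qed.

(** Integrate [1 + u <= expR u] at [u = 3/8 * X^2]. *)
Lemma second_moment_le : (second_moment <= 8 / 3)%R.
Proof.
have : \int[Pr]_w (1 + 3 / 8 * X w ^+ 2)%:E <= 2%:E.
  apply: (le_trans _ mgf_subgaussian_expR_sqr); apply: ge0_le_integral => //.
  - by move=> w _; rewrite lee_fin; have := sqr_ge0 (X w); lra.
  - apply/measurable_EFinP; apply: measurable_funD => //.
    exact: measurable_funM.
  - by apply/measurable_EFinP.
  - by move=> w _; rewrite lee_fin expR_ge1Dx.
under eq_integral do rewrite EFinD EFinM.
rewrite integralD//; last 2 first.
- exact: finite_measure_integrable_cst.
- by apply: integrableZl => //; exact: integrable_sqr.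
rewrite integral_cst//= probability_setT mule1 integralZl//; last first.
  exact: integrable_sqr.
rewrite second_momentE -EFinM -EFinD lee_fin; lra.
Qed.

(** The remainder of the quadratic expansion is 5/8 a^2 X^4 exp(|a| X^2). Of the available exponent
    3/8 X^2 the range of [a] spends 1/8, and the remaining 1/4 absorbs X^4 <= 16 exp(X^2/4). So the
    remainder is at most 10 a^2 exp(3/8 X^2), of mean at most 20 a^2. *)
Lemma mgf_subgaussian_sqr (a : R) : (`|a| <= 1 / 8)%R ->
  \int[Pr]_w (expR (a * (X w ^+ 2 - second_moment)))%:E
    <= (expR (20 * a ^+ 2))%:E.
Proof.
move=> a1.
have mZ c : Pr.-integrable setT (fun w => (c * X w ^+ 2)%:E).
  exact: (integrableZl measurableT c integrable_sqr).
have mE c : Pr.-integrable setT (fun w => (c * expR (3 / 8 * X w ^+ 2))%:E).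
  exact: (integrableZl measurableT c integrable_expR_sqr).
have H : \int[Pr]_w (expR (a * X w ^+ 2))%:E
    <= (expR (a * second_moment + 20 * a ^+ 2))%:E.
  apply: (@le_trans _ _ (\int[Pr]_w (1%:E + (a * X w ^+ 2)%:E +
      (10 * a ^+ 2 * expR (3 / 8 * X w ^+ 2))%:E))).
    apply: ge0_le_integral => //.
    - by apply/measurable_EFinP.
    - apply/measurable_EFinP; apply: measurable_funD => //; last exact: measurable_funM.
      by apply: measurable_funD => //; exact: measurable_funM.
    move=> w _; rewrite -!EFinD lee_fin.
    apply: (le_trans (expR_le_quadratic _)); rewrite lerD2l.
    set x := (X w ^+ 2)%R; have x0 : (0 <= x)%R by exact: sqr_ge0.
    rewrite normrM (ger0_norm x0) exprMn.
    have H1 : (expR (`|a| * x) <= expR (x / 8))%R by rewrite ler_expR; nra.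
    have x4 : (0 <= x / 4)%R by lra.
    have H2 := sqr_le_expR x4.
    have -> : (3 / 8 * x = x / 4 + x / 8)%R by lra.
    rewrite expRD.
    move: (expR (`|a| * x)) (expR (x / 8)) (expR (x / 4)) (expR_gt0 (x / 8))
      (expR_gt0 (`|a| * x)) H1 H2 => E1 E2 E3 E20 E10 E12 xE3.
    have H3 : (x ^+ 2 <= 16 * E3)%R by move: xE3; rewrite expr_div_n; lra.
    have : (x ^+ 2 * E1 <= 16 * E3 * E2)%R by rewrite ler_pM// ?sqr_ge0// ltW.
    have := sqr_ge0 a; nra.
  rewrite integralD//; last first.
    by apply: integrableD => //; exact: finite_measure_integrable_cst.
  rewrite integralD//; last exact: finite_measure_integrable_cst.
  rewrite integral_cst//= probability_setT mule1.
  under eq_integral do rewrite EFinM.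
  rewrite integralZl//; last exact: integrable_sqr.
  rewrite second_momentE.
  under [X in _ + X]eq_integral do rewrite EFinM.
  rewrite integralZl//; last exact: integrable_expR_sqr.
  apply: (@le_trans _ _ (1%:E + a%:E * second_moment%:E + (10 * a ^+ 2)%:E * 2%:E)).
    rewrite leeD2l// lee_wpmul2l//; last exact: mgf_subgaussian_expR_sqr.
    by rewrite lee_fin mulr_ge0// sqr_ge0.
  rewrite -!EFinM -!EFinD lee_fin; apply: le_trans (expR_ge1Dx _); lra.
under eq_integral do rewrite mulrBr expRD mulrC EFinM.
rewrite ge0_integralZl//; last by apply/measurable_EFinP.
apply: le_trans.
  by apply: lee_wpmul2l; [rewrite lee_fin expR_ge0|exact: H].
rewrite -EFinM -expRD lee_fin ler_expR; lra.
Qed.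

(* Cauchy-Schwarz, as AM-GM between the two normalised exponentials. *)
Lemma mgf_subgaussian_quadratic (a b : R) : (`|a| <= 1 / 8)%R ->
  \int[Pr]_w (expR (a / 2 * (X w ^+ 2 - second_moment) + b * X w))%:E
    <= (expR (10 * a ^+ 2 + b ^+ 2))%:E.
Proof.
move=> a1.
set f1 := fun w => expR (a * (X w ^+ 2 - second_moment)).
set f2 := fun w => expR ((2 * b) * X w).
have m1 : measurable_fun setT f1.
  apply: measurableT_comp => //; apply: measurable_funM => //.
  exact: measurable_funB.
have m2 : measurable_fun setT f2.
  by apply: measurableT_comp => //; exact: measurable_funM.
(* Since [c1 * c2 = 1/4], AM-GM bounds the product of the two factors; the weights make both terms
   have the same bound, half of the final one. *)
pose c1 : R := (expR (b ^+ 2 - 10 * a ^+ 2) / 2)%R.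
pose c2 : R := (expR (10 * a ^+ 2 - b ^+ 2) / 2)%R.
have c10 : (0 <= c1)%R by rewrite divr_ge0// expR_ge0.
have c20 : (0 <= c2)%R by rewrite divr_ge0// expR_ge0.
apply: (@le_trans _ _ (\int[Pr]_w (c1%:E * (f1 w)%:E + c2%:E * (f2 w)%:E))).
  apply: ge0_le_integral => //.
  - apply/measurable_EFinP; apply: measurableT_comp => //; apply: measurable_funD.
      by apply: measurable_funM => //; exact: measurable_funB.
    exact: measurable_funM.
  - apply/measurable_EFinP; apply: measurable_funD; exact: measurable_funM.
  move=> w _; rewrite -!EFinM -EFinD lee_fin.
  set u := (b ^+ 2 - 10 * a ^+ 2)%R.
  set p := (a / 2 * (X w ^+ 2 - second_moment))%R.
  have -> : f1 w = (expR p * expR p)%R by rewrite -expRD; congr expR; rewrite /p; lra.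
  have -> : f2 w = (expR (b * X w) * expR (b * X w))%R.
    by rewrite -expRD; congr expR; lra.
  rewrite /c2 (_ : 10 * a ^+ 2 - b ^+ 2 = - u)%R; last by rewrite /u; lra.
  rewrite /c1 -/u (_ : u = u / 2 + u / 2)%R; last lra.
  rewrite opprD !expRD.
  have := expR_gt0 (u / 2); have := expR_gt0 (- (u / 2)).
  have : (expR (u / 2) * expR (- (u / 2)) = 1)%R by rewrite -expRD subrr expR0.
  move: (expR (u / 2)) (expR (- (u / 2))) (expR p) (expR (b * X w)) => A B x y AB _ _.
  have : (0 <= (A * x - B * y) ^+ 2)%R by exact: sqr_ge0.
  have : (A * x * (B * y) = x * y)%R by rewrite mulrACA AB mul1r.
  nra.
rewrite ge0_integralD//; last 4 first.
- by move=> w _; rewrite -EFinM lee_fin mulr_ge0// expR_ge0.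
- by apply/measurable_EFinP; exact: measurable_funM.
- by move=> w _; rewrite -EFinM lee_fin mulr_ge0// expR_ge0.
- by apply/measurable_EFinP; exact: measurable_funM.
rewrite !ge0_integralZl//.
- apply: (@le_trans _ _ (c1%:E * (expR (20 * a ^+ 2))%:E +
    c2%:E * (expR ((2 * b) ^+ 2 / 2))%:E)).
    apply: leeD; rewrite lee_wpmul2l//; first exact: mgf_subgaussian_sqr.
    exact: X_mgf.
  rewrite -!EFinM -EFinD lee_fin /c1 /c2 !(mulrAC _ (2^-1)%R) -!expRD.
  rewrite (_ : b ^+ 2 - 10 * a ^+ 2 + 20 * a ^+ 2 = 10 * a ^+ 2 + b ^+ 2)%R; last lra.
  rewrite (_ : 10 * a ^+ 2 - b ^+ 2 + (2 * b) ^+ 2 / 2 = 10 * a ^+ 2 + b ^+ 2)%R.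
    lra.
  by rewrite exprMn; lra.
- by apply/measurable_EFinP.
- by move=> w _; rewrite lee_fin expR_ge0.
- by apply/measurable_EFinP.
- by move=> w _; rewrite lee_fin expR_ge0.
Qed.

End subgaussian_square.

(** * Independence of the first coordinate from the others *)

Section independence.
Context d (T : measurableType d) (R : realType) (Pr : probability T R).

Definition tuple_rectangles n : set (set (n.-tuple R)) :=
  [set C | exists2 B : 'I_n -> set R, (forall i, measurable (B i)) &
    C = \bigcap_i ((@tnth n R)^~ i @^-1` B i)].

Lemma measurable_tuple_rectangles n :
  @measurable _ (n.-tuple R) = <<s @tuple_rectangles n >>.
Proof.
apply/seteqP; split.
  apply: smallest_sub; first exact: smallest_sigma_algebra.
  rewrite -bigcup_seq => _ [/= i _ [A mA <-]]; apply: sub_gen_smallest.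
  exists (fun j => if j == i then A else setT).
    by move=> j; case: ifP.
  apply/seteqP; split=> [t [_ At] j _ /=|t /(_ i I)/=].
    by case: eqP => [->|].
  by rewrite eqxx.
apply: smallest_sub; first exact: sigma_algebra_measurable.
move=> _ [B mB ->]; apply: fin_bigcap_measurable; first exact: finite_finset.
move=> i _; rewrite -[X in measurable X]setTI; exact: measurable_tnth.
Qed.

Lemma tuple_rectangles_setI n : setI_closed (@tuple_rectangles n).
Proof.
move=> _ _ [A mA ->] [B mB ->]; exists (fun i => A i `&` B i).
  by move=> i; exact: measurableI.
by rewrite -bigcapI.
Qed.

Lemma tuple_rectangles_setT n : @tuple_rectangles n setT.
Proof. by exists (fun=> setT) => //; apply/seteqP; split. Qed.

Variables (n : nat) (X : 'I_n.+1 -> {RV Pr >-> R}).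
Hypothesis X_indep : mutually_independent Pr X.

Definition rv_tail (w : T) : n.-tuple R := [tuple X (lift ord0 i) w | i < n].

Lemma measurable_rv_tail : measurable_fun setT rv_tail.
Proof.
apply/measurable_fun_tnthP => i.
rewrite (_ : _ \o _ = X (lift ord0 i))//.
by apply/funext => w /=; rewrite tnth_mktuple.
Qed.

HB.instance Definition _ := isMeasurableFun.Build _ _ _ _ rv_tail measurable_rv_tail.

Lemma mutually_independent_lift :
  mutually_independent Pr (fun i => X (lift ord0 i)).
Proof.
move=> B mB.
have := @X_indep (fun i => oapp B setT (unlift ord0 i)).
rewrite big_ord_recl unlift_none /= preimage_setT probability_setT mul1e.
under eq_bigr do rewrite liftK.
move=> <-; last by move=> i; case: unliftP => /=.
congr (Pr _); apply/seteqP; split => w /= Hw i _.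
  by case: unliftP => //= j ->; exact: Hw.
by have := Hw (lift ord0 i) I; rewrite /= liftK.
Qed.

(** For fixed [A] both sides are finite measures in [C]. They agree on rectangles by mutual
    independence, and rectangles form a pi-system generating the sigma-algebra of tuples. *)
Lemma head_tail_independent A C : measurable A -> measurable C ->
  Pr (X ord0 @^-1` A `&` rv_tail @^-1` C)
    = (Pr (X ord0 @^-1` A) * Pr (rv_tail @^-1` C))%E.
Proof.
move=> mA mC.
have mXA : measurable (X ord0 @^-1` A).
  by rewrite -[X in measurable X]setTI; exact: measurable_funPT.
pose c : {nonneg R} := NngNum (fine_ge0 (measure_ge0 Pr (X ord0 @^-1` A))).
pose m0 : {measure set _ -> \bar R} := pushforward (mrestr Pr mXA) rv_tail.
pose m1 := m0 measurable_rv_tail.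
pose m2 : {measure set _ -> \bar R} := mscale c (distribution Pr rv_tail).
have m1E D : m1 D = Pr (X ord0 @^-1` A `&` rv_tail @^-1` D).
  by rewrite setIC.
have m2E D : m2 D = (Pr (X ord0 @^-1` A) * Pr (rv_tail @^-1` D))%E.
  by rewrite /m2 /= /mscale/= fineK// fin_num_measure.
rewrite -m1E -m2E.
apply: (measure_unique (@tuple_rectangles n) (fun=> setT)) => //.
- exact: measurable_tuple_rectangles.
- exact: tuple_rectangles_setI.
- by move=> _; exact: tuple_rectangles_setT.
- exact: bigcup_const.
- move=> _ [B mB ->]; rewrite m1E m2E.
  have mBA i : measurable (oapp B A (unlift ord0 i)) by case: unliftP => /=.
  have := X_indep mBA.
  rewrite big_ord_recl unlift_none /=.
  under eq_bigr do rewrite liftK.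
  move=> H.
  transitivity (Pr (X ord0 @^-1` A) *
      (\prod_(i < n) Pr (X (lift ord0 i) @^-1` B i)))%E.
    rewrite -H; congr (Pr _); apply/seteqP; split => w /=.
      move=> [XA XB] i _; case: unliftP => [j|] -> //=.
      by have := XB j I; rewrite /= tnth_mktuple.
    move=> Hw; split; first by have := Hw ord0 I; rewrite unlift_none.
    move=> j _ /=; rewrite tnth_mktuple.
    by have := Hw (lift ord0 j) I; rewrite /= liftK.
  congr (_ * _)%E; rewrite -mutually_independent_lift//.
  congr (Pr _); apply/seteqP; split => w /= Hw j _ /=.
    by rewrite tnth_mktuple; exact: Hw.
  by have := Hw j I; rewrite /= tnth_mktuple.
- by move=> _; rewrite m1E (le_lt_trans (probability_le1 _ _)) ?ltry//;
    apply: measurableI => //; rewrite preimage_setT.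
Qed.

(** The joint law of head and tail is the product of their laws, so the head can be integrated out
    with the tail frozen. This is the induction step of the Hanson-Wright bound. *)
Lemma integral_head_tail_le (g : R * n.-tuple R -> \bar R)
    (h : n.-tuple R -> \bar R) :
  measurable_fun setT g -> (forall x, 0 <= g x)%E ->
  measurable_fun setT h -> (forall y, 0 <= h y)%E ->
  (forall y, \int[Pr]_w g (X ord0 w, y) <= h y)%E ->
  (\int[Pr]_w g (X ord0 w, rv_tail w) <= \int[Pr]_w h (rv_tail w))%E.
Proof.
move=> mg g0 mh h0 gh.
pose P1 := distribution Pr (X ord0).
pose P2 := distribution Pr rv_tail.
have mXY : measurable_fun setT (fun w => (X ord0 w, rv_tail w)).
  by apply/measurable_fun_pairP; split.
pose XY : {mfun T >-> (R * n.-tuple R)%type} := mfun_Sub (mem_set mXY).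
have -> : (\int[Pr]_w g (X ord0 w, rv_tail w) = \int[distribution Pr XY]_z g z)%E.
  by rewrite ge0_integral_distribution.
have -> : (\int[Pr]_w h (rv_tail w) = \int[P2]_y h y)%E.
  by rewrite ge0_integral_distribution.
have -> : (\int[distribution Pr XY]_z g z = \int[P1 \x P2]_z g z)%E.
  apply: eq_measure_integral => A mA _.
  apply/esym/product_measure_unique => // B C mB mC.
  exact: head_tail_independent.
rewrite fubini_tonelli2//; apply: ge0_le_integral => //.
- by move=> y _; exact: integral_ge0.
- exact: measurable_fun_fubini_tonelli_G.
move=> y _; apply: le_trans (gh y).
rewrite /fubini_G ge0_integral_distribution//.
exact: measurableT_comp.
Qed.

End independence.

(** * Quadratic forms and their rank one updates *)

Section quadratic_forms.
Context {R : realType}.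

Definition quadratic_form n (K : 'I_n -> 'I_n -> R) (x : 'I_n -> R) : R :=
  \sum_i \sum_j K i j * x i * x j.

Lemma quadratic_form_recl n (K : 'I_n.+1 -> 'I_n.+1 -> R) x :
  (forall i j, K i j = K j i) ->
  quadratic_form K x = K ord0 ord0 * x ord0 ^+ 2
    + 2 * x ord0 * (\sum_i K ord0 (lift ord0 i) * x (lift ord0 i))
    + quadratic_form (fun i j => K (lift ord0 i) (lift ord0 j))
        (fun i => x (lift ord0 i)).
Proof.
move=> K_sym; rewrite /quadratic_form big_ord_recl big_ord_recl.
under [X in _ + X = _]eq_bigr do rewrite big_ord_recl.
rewrite big_split /=.
set k := \sum_(i < n) K ord0 (lift ord0 i) * _.
have -> : \sum_(i < n) K ord0 (lift ord0 i) * x ord0 * x (lift ord0 i) = x ord0 * k.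
  by rewrite mulr_sumr; apply: eq_bigr => i _; ring.
have -> : \sum_(i < n) K (lift ord0 i) ord0 * x (lift ord0 i) * x ord0 = x ord0 * k.
  by rewrite mulr_sumr; apply: eq_bigr => i _; rewrite (K_sym _ ord0); ring.
by rewrite expr2; ring.
Qed.

Lemma quadratic_form_rank1 n (K : 'I_n -> 'I_n -> R) (c : R) (k x : 'I_n -> R) :
  quadratic_form (fun i j => K i j + c * (k i * k j)) x
    = quadratic_form K x + c * (\sum_i k i * x i) ^+ 2.
Proof.
rewrite /quadratic_form expr2 mulr_suml mulr_sumr -big_split/=.
apply: eq_bigr => i _; rewrite !mulr_sumr -big_split/=.
by apply: eq_bigr => j _; ring.
Qed.

Definition ord_cons n (c : R) (x : 'I_n -> R) (i : 'I_n.+1) : R :=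
  oapp x c (unlift ord0 i).

Lemma ord_cons0 n c (x : 'I_n -> R) : ord_cons c x ord0 = c.
Proof. by rewrite /ord_cons unlift_none. Qed.

Lemma ord_cons_lift n c (x : 'I_n -> R) i : ord_cons c x (lift ord0 i) = x i.
Proof. by rewrite /ord_cons liftK. Qed.

Lemma quadratic_form_cons n (K : 'I_n.+1 -> 'I_n.+1 -> R) c x :
  (forall i j, K i j = K j i) ->
  quadratic_form K (ord_cons c x) = K ord0 ord0 * c ^+ 2
    + 2 * c * (\sum_i K ord0 (lift ord0 i) * x i)
    + quadratic_form (fun i j => K (lift ord0 i) (lift ord0 j)) x.
Proof.
move=> K_sym; rewrite quadratic_form_recl// ord_cons0.
congr (_ + _ * _ + _).
  by apply: eq_bigr => i _; rewrite ord_cons_lift.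
by congr quadratic_form; apply/funext => i; rewrite ord_cons_lift.
Qed.

Lemma sum_sqr_cons n c (x : 'I_n -> R) :
  \sum_i ord_cons c x i ^+ 2 = c ^+ 2 + \sum_i x i ^+ 2.
Proof.
rewrite big_ord_recl ord_cons0; congr (_ + _).
by apply: eq_bigr => i _; rewrite ord_cons_lift.
Qed.

Section bounded_form.
Variables (n : nat) (K : 'I_n.+1 -> 'I_n.+1 -> R).
Hypothesis K_sym : forall i j, K i j = K j i.
Hypothesis K_bd : forall x, `|quadratic_form K x| <= 1 / 8 * \sum_i x i ^+ 2.
Let k i := K ord0 (lift ord0 i).
Let K' i j := K (lift ord0 i) (lift ord0 j).

Let cons_bd c x : `|K ord0 ord0 * c ^+ 2 + 2 * c * (\sum_i k i * x i)
    + quadratic_form K' x| <= 1 / 8 * (c ^+ 2 + \sum_i x i ^+ 2).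
Proof. by rewrite -quadratic_form_cons// -sum_sqr_cons. Qed.

Lemma quadratic_form_head_le : `|K ord0 ord0| <= 1 / 8.
Proof.
have := cons_bd 1 (fun=> 0); rewrite big1; last by move=> i _; rewrite mulr0.
rewrite big1; last by move=> i _; rewrite expr0n.
rewrite /quadratic_form big1; last first.
  by move=> i _; rewrite big1// => j _; rewrite mulr0.
by rewrite expr1n mulr0 !addr0 !mulr1.
Qed.

Lemma quadratic_form_tail_bd x : `|quadratic_form K' x| <= 1 / 8 * \sum_i x i ^+ 2.
Proof. by have := cons_bd 0 x; rewrite expr0n/= !mulr0 mul0r !add0r. Qed.

(* Testing the bound on the vector (2 k.x, x) bounds the form of the rest of K
   updated by 2 k k^T, k being the off-diagonal part of the first row. *)
Lemma quadratic_form_schur x :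
  `|quadratic_form (fun i j => K' i j + 2 * (k i * k j)) x|
    <= 1 / 8 * \sum_i x i ^+ 2.
Proof.
rewrite quadratic_form_rank1.
set t := \sum_i k i * x i.
move: (cons_bd (2 * t) x) (quadratic_form_tail_bd x) quadratic_form_head_le.
rewrite -/t !ler_norml => /andP[a1 a2] /andP[b1 b2] /andP[c1 c2].
have t0 := sqr_ge0 t; apply/andP; split; nra.
Qed.

(** Test the bound on the vector (1/4, k): the cross term is |k|^2/2, and all other terms together
    amount to at most |k|^2/4 + 1/64. *)
Lemma quadratic_form_offdiag_le : \sum_i k i ^+ 2 <= 1 / 16.
Proof.
move: (cons_bd (1 / 4) k) (quadratic_form_tail_bd k) quadratic_form_head_le.
have -> : \sum_i k i * k i = \sum_i k i ^+ 2 by [].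
rewrite !ler_norml => /andP[a1 a2] /andP[b1 b2] /andP[c1 c2].
nra.
Qed.

(** The update adds four times the form at [k], at most |k|^2/2, and 4 |k|^4, at most |k|^2/4. This
    stays below the 2 |k|^2 released by deleting the first row and column. *)
Lemma sum_sqr_schur_le :
  \sum_i \sum_j (K' i j + 2 * (k i * k j)) ^+ 2
    <= \sum_i \sum_j K' i j ^+ 2 + 3 / 4 * \sum_i k i ^+ 2.
Proof.
have -> : \sum_i \sum_j (K' i j + 2 * (k i * k j)) ^+ 2 =
    \sum_i \sum_j K' i j ^+ 2 + 4 * quadratic_form K' k
      + 4 * (\sum_i k i ^+ 2) ^+ 2.
  rewrite /quadratic_form (expr2 (\sum_i k i ^+ 2)) mulr_suml !mulr_sumr.
  rewrite -!big_split/=; apply: eq_bigr => i _.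
  rewrite !mulr_sumr -!big_split/=; apply: eq_bigr => j _; ring.
have := quadratic_form_tail_bd k; rewrite ler_norml => /andP[_ H].
have := quadratic_form_offdiag_le.
have : 0 <= \sum_i k i ^+ 2 by apply: sumr_ge0 => i _; exact: sqr_ge0.
nra.
Qed.

End bounded_form.

End quadratic_forms.

(** * The Hanson-Wright bound for exponential moments *)

Section hanson_wright.
Context d (T : measurableType d) (R : realType) (Pr : probability T R).

(* The coordinates are integrated out one at a time: averaging over the first
   one leaves a form of the same kind in the others, the matrix of which is
   updated by a rank one term. *)
Lemma hanson_wright_mgf n (X : 'I_n -> {RV Pr >-> R}) (K : 'I_n -> 'I_n -> R) :
  mutually_independent Pr X -> (forall i, mgf_subgaussian Pr (X i)) ->
  (forall i j, K i j = K j i) ->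
  (forall x, `|quadratic_form K x| <= 1 / 8 * \sum_i x i ^+ 2) ->
  (\int[Pr]_w (expR ((quadratic_form K (fun i => X i w)
      - \sum_i second_moment (X i) * K i i) / 2))%:E
   <= (expR (10 * \sum_i \sum_j K i j ^+ 2))%:E)%E.
Proof.
elim: n => [|n IH] in X K * => X_indep X_mgf K_sym K_bd.
  under eq_integral do rewrite /quadratic_form !big_ord0 subr0 mul0r.
  by rewrite integral_cst//= big_ord0 mulr0 expR0 mul1e probability_le1.
set a := K ord0 ord0; pose k i := K ord0 (lift ord0 i).
pose K' i j := K (lift ord0 i) (lift ord0 j).
pose s i := second_moment (X i).
pose X' i := X (lift ord0 i).
pose K1 i j := K' i j + 2 * (k i * k j).
pose q (y : n.-tuple R) := (quadratic_form K' (fun i => tnth y i)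
    - \sum_i s (lift ord0 i) * K' i i) / 2.
pose ky (y : n.-tuple R) := \sum_i k i * tnth y i.
have mky : measurable_fun setT ky.
  apply: measurable_sum => i; apply: measurable_funM => //.
  exact: measurable_tnth.
have mq : measurable_fun setT q.
  apply: measurable_funM => //; apply: measurable_funB => //.
  apply: measurable_sum => i; apply: measurable_sum => j.
  apply: measurable_funM; last exact: measurable_tnth.
  by apply: measurable_funM => //; exact: measurable_tnth.
(* With the tail fixed the exponent is a quadratic polynomial in the first coordinate, with linear
   coefficient [ky]; [h] is the bound left after integrating that coordinate out. *)
pose g (p : R * n.-tuple R) : \bar R :=
  (expR (a / 2 * (p.1 ^+ 2 - s ord0) + ky p.2 * p.1) * expR (q p.2))%:E.
pose h (y : n.-tuple R) : \bar R :=
  (expR (10 * a ^+ 2 + ky y ^+ 2) * expR (q y))%:E.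
have a8 : `|a| <= 1 / 8 by exact: quadratic_form_head_le.
have := @integral_head_tail_le _ _ _ Pr n X X_indep g h.
have mg : measurable_fun setT g.
  apply/measurable_EFinP; apply: measurable_funM.
    apply: measurableT_comp => //; apply: measurable_funD.
      apply: measurable_funM => //; apply: measurable_funB => //.
      exact: measurable_funX.
    by apply: measurable_funM => //; exact: measurableT_comp.
  by apply: measurableT_comp => //; exact: measurableT_comp.
have mh : measurable_fun setT h.
  apply/measurable_EFinP; apply: measurable_funM; apply: measurableT_comp => //.
  by apply: measurable_funD => //; exact: measurable_funX.
move=> /(_ mg _ mh) gh.
apply: (@le_trans _ _ (\int[Pr]_w h (rv_tail X w))%E).
  apply: le_trans (gh _ _ _).
  - rewrite le_eqVlt; apply/predU1P; left; apply: eq_integral => w _.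
    rewrite /g -expRD; congr (expR _)%:E.
    rewrite quadratic_form_recl// big_ord_recl /=.
    rewrite /q /ky; under [X in _ = _ + X * _ + _]eq_bigr do rewrite tnth_mktuple.
    have -> : tnth (rv_tail X w) = fun i => X (lift ord0 i) w.
      by apply/funext => i; rewrite tnth_mktuple.
    rewrite -/a -/(s ord0) -/K' -/k.
    by field.
  - by move=> p; rewrite lee_fin mulr_ge0// expR_ge0.
  - by move=> p; rewrite lee_fin mulr_ge0// expR_ge0.
  - move=> y; rewrite /g /h /=.
    under eq_integral do rewrite mulrC EFinM.
    rewrite ge0_integralZl//; last first.
      apply/measurable_EFinP; apply: measurableT_comp => //.
      apply: measurable_funD; last exact: measurable_funM.
      apply: measurable_funM => //; apply: measurable_funB => //.
      exact: measurable_funX.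
    rewrite [X in (_ <= X%:E)%E]mulrC EFinM lee_wpmul2l// ?lee_fin ?expR_ge0//.
    exact: mgf_subgaussian_quadratic.
(* Absorbing [ky^2] into the form with matrix [K1] also subtracts its mean, the sum of [s * k^2];
   [c] gives this back. *)
pose c := 10 * a ^+ 2 + \sum_i s (lift ord0 i) * k i ^+ 2.
have -> : (\int[Pr]_w h (rv_tail X w) = \int[Pr]_w ((expR c)%:E *
    (expR ((quadratic_form K1 (fun i => X' i w)
      - \sum_i second_moment (X' i) * K1 i i) / 2))%:E))%E.
  apply: eq_integral => w _; rewrite /h -EFinM -!expRD; congr (expR _)%:E.
  rewrite /q /ky quadratic_form_rank1 /c.
  have -> : tnth (rv_tail X w) = fun i => X' i w.
    by apply/funext => i; rewrite tnth_mktuple.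
  have -> : \sum_i second_moment (X' i) * K1 i i =
      \sum_i s (lift ord0 i) * K' i i + 2 * \sum_i s (lift ord0 i) * k i ^+ 2.
    rewrite mulr_sumr -big_split/=; apply: eq_bigr => i _.
    by rewrite /K1 /X' /s; ring.
  by field.
rewrite ge0_integralZl//; last first.
  apply/measurable_EFinP; apply: measurableT_comp => //.
  apply: measurable_funM => //; apply: measurable_funB => //.
  apply: measurable_sum => i; apply: measurable_sum => j.
  by apply: measurable_funM => //; exact: measurable_funM.
apply: le_trans.
  apply: lee_wpmul2l; first by rewrite lee_fin expR_ge0.
  apply: IH => //.
  - exact: mutually_independent_lift.
  - by move=> i; exact: X_mgf.
  - by move=> i j; rewrite /K1; congr (_ + 2 * _); [exact: K_sym|exact: mulrC].
  - exact: quadratic_form_schur.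
rewrite -EFinM -expRD lee_fin ler_expR.
(* Budget in units of |k|^2: the mean costs 8/3 and the update 10 * 3/4, against the 20 that the
   first row and column provide. *)
have sk : \sum_i s (lift ord0 i) * k i ^+ 2 <= 8 / 3 * \sum_i k i ^+ 2.
  rewrite mulr_sumr; apply: ler_sum => i _.
  by rewrite ler_wpM2r ?sqr_ge0// second_moment_le.
have HS := sum_sqr_schur_le K_sym K_bd.
have -> : \sum_i \sum_j K i j ^+ 2 = a ^+ 2 + 2 * \sum_i k i ^+ 2
     + \sum_i \sum_j K' i j ^+ 2.
  rewrite big_ord_recl big_ord_recl.
  under [X in _ + X = _]eq_bigr do rewrite big_ord_recl K_sym.
  by rewrite big_split/= -/a; rewrite /k /K'; ring.
have : 0 <= \sum_i k i ^+ 2 by apply: sumr_ge0 => i _; exact: sqr_ge0.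
rewrite /c; move: HS sk; rewrite /K1 /K' /k; lra.
Qed.

End hanson_wright.

(** * Averages over finitely many patterns and over random signs *)

Section finite_averages.
Context {R : realType}.

(** A value in [[0, b]] has a square of at most [b] times itself, so the mean controls the second
    moment; this yields [b * ET] where boundedness alone would give [M * b^2]. The sum over
    functions factorises over the channel uses. *)
Lemma sum_expR_independent_le (M : nat) (C : finType) (g : 'I_M -> C -> R)
    (b l ET : R) :
  (forall m c, 0 <= g m c <= b) -> `|l| * b <= 3 / 8 ->
  #|C|%:R * ET = \sum_m \sum_c g m c -> (0 < #|C|)%N ->
  \sum_(u : {ffun 'I_M -> C}) expR (l * (\sum_m g m (u m) - ET))
    <= #|{ffun 'I_M -> C}|%:R * expR (l ^+ 2 * b * ET).
Proof.
set N : R := #|C|%:R; move=> gb lb ET_def C0.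
have N0 : N != 0 by rewrite pnatr_eq0 -lt0n.
pose E m := N^-1 * \sum_c g m c.
have ETE : ET = \sum_m E m by rewrite -mulr_sumr -ET_def mulKf.
have one m : \sum_c expR (l * g m c) <= N * expR (l * E m + l ^+ 2 * b * E m).
  apply: (@le_trans _ _ (\sum_c (1 + (l + l ^+ 2 * b) * g m c))).
    apply: ler_sum => c _; have /andP[g0 gb'] := gb m c.
    have lg : `|l * g m c| <= 3 / 8.
      by rewrite normrM (ger0_norm g0); apply: le_trans lb; rewrite ler_wpM2l.
    apply: (le_trans (expR_le_quadratic1 lg)).
    have : l ^+ 2 * (g m c * g m c) <= l ^+ 2 * (b * g m c).
      by rewrite ler_wpM2l ?sqr_ge0// ler_wpM2r.
    rewrite exprMn (expr2 (g m c)); lra.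
  rewrite big_split/= sumr_const -mulr_sumr -[\sum_c g m c](mulVKf N0) -/(E m).
  rewrite -/N (_ : N + _ = N * (1 + (l * E m + l ^+ 2 * b * E m))); last by ring.
  by rewrite ler_wpM2l ?ler0n// expR_ge1Dx.
under eq_bigr => u _ do rewrite mulrBr expRD mulr_sumr expR_sum.
rewrite -mulr_suml -(bigA_distr_bigA (fun m c => expR (l * g m c))).
rewrite -mulrN ETE.
have H : \prod_m \sum_c expR (l * g m c)
    <= #|{ffun 'I_M -> C}|%:R * expR (l * ET + l ^+ 2 * b * ET).
  apply: (@le_trans _ _ (\prod_(m < M) (N * expR (l * E m + l ^+ 2 * b * E m)))).
    by apply: ler_prod => m _; rewrite one sumr_ge0// => c _; exact: expR_ge0.
  rewrite big_split/= prodr_const card_ord card_ffun card_ord natrX -expR_sum.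
  by rewrite ETE !mulr_sumr -big_split.
apply: le_trans (ler_wpM2r _ H) _; first exact: expR_ge0.
rewrite -[X in X <= _]mulrA -expRD -ETE mulrN.
by rewrite (_ : _ - _ = l ^+ 2 * b * ET)//; ring.
Qed.

Definition rademacher K (c : {ffun 'I_K -> bool}) (k : 'I_K) : R := (-1) ^+ c k.

Lemma rademacher_sqr K (c : {ffun 'I_K -> bool}) k : rademacher c k ^+ 2 = 1.
Proof. by rewrite /rademacher sqrr_sign. Qed.

(** Flipping the sign at [k] is an involution that negates every term. *)
Lemma sum_rademacher_cancel K (k : 'I_K) (F : {ffun 'I_K -> bool} -> R) :
  (forall c c' : {ffun 'I_K -> bool}, (forall j, j != k -> c j = c' j) -> F c = F c') ->
  \sum_c rademacher c k * F c = 0.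
Proof.
move=> F_indep.
pose flip (c : {ffun 'I_K -> bool}) := [ffun j => c j (+) (j == k)].
have flipK : involutive flip.
  by move=> c; apply/ffunP => j; rewrite !ffunE addbK.
have H : \sum_c rademacher c k * F c = - \sum_c rademacher c k * F c.
  rewrite [LHS](reindex_inj (inv_inj flipK)) -sumrN; apply: eq_bigr => c _.
  rewrite (F_indep (flip c) c); last first.
    by move=> j jk; rewrite ffunE (negbTE jk) addbF.
  by rewrite /rademacher ffunE eqxx addbT signrN mulNr.
lra.
Qed.

(** Here the cross terms disappear, both among users and between users and the noise, which is
    represented by [w0]. *)
Lemma sum_rademacher_sqr K (w0 : R) (w : 'I_K -> R) :
  \sum_(c : {ffun 'I_K -> bool}) (w0 + \sum_k rademacher c k * w k) ^+ 2
    = #|{ffun 'I_K -> bool}|%:R * (w0 ^+ 2 + \sum_k w k ^+ 2).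
Proof.
have H1 k : \sum_(c : {ffun 'I_K -> bool}) rademacher c k * (2 * w0 * w k) = 0.
  exact: sum_rademacher_cancel.
have H2 k : \sum_(c : {ffun 'I_K -> bool})
    rademacher c k * (w k * \sum_(j | j != k) rademacher c j * w j) = 0.
  apply: sum_rademacher_cancel => c c' cc'; congr (_ * _); apply: eq_bigr => j jk.
  by rewrite /rademacher cc'.
have E c : (w0 + \sum_k rademacher c k * w k) ^+ 2 = w0 ^+ 2 + \sum_k w k ^+ 2 +
    \sum_k (rademacher c k * (2 * w0 * w k) +
      rademacher c k * (w k * \sum_(j | j != k) rademacher c j * w j)).
  have -> : \sum_k (rademacher c k * (2 * w0 * w k) +
      rademacher c k * (w k * \sum_(j | j != k) rademacher c j * w j)) =
      \sum_k (rademacher c k * w k * (2 * w0 + \sum_j rademacher c j * w j)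
        - w k ^+ 2).
    apply: eq_bigr => k _; rewrite [\sum_j _](bigD1 k)//=.
    by have := rademacher_sqr c k; rewrite expr2 => rk; ring: rk.
  by rewrite sumrB -mulr_suml; ring.
under eq_bigr => c _ do rewrite E.
rewrite big_split/= sumr_const [X in _ + X]exchange_big/= [X in _ + X]big1.
  by rewrite addr0 mulr_natl.
by move=> k _; rewrite big_split/= H1 H2 addr0.
Qed.

End finite_averages.

(** * Gram matrices and the energy of a linear image *)

Lemma linear_le_quadratic_eq0 (R : realFieldType) (D C t0 : R) : 0 < t0 ->
  0 <= C -> (forall t, `|t| <= t0 -> t * D <= C * t ^+ 2) -> D = 0.
Proof.
move=> t00 C0 H; apply/eqP; apply: contraT => D0.
(* At the point of size [e] with the sign of [D], the left side is e |D| >= (C + 1) e^2, which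
   exceeds the allowed C e^2. *)
pose e := Num.min t0 (`|D| / (C + 1)).
have nD : 0 < `|D| by rewrite normr_gt0.
have e0 : 0 < e by rewrite lt_min t00 divr_gt0//; lra.
have et : e <= t0 by rewrite ge_min lexx.
have eD : e * (C + 1) <= `|D|.
  by rewrite -ler_pdivlMr; [rewrite ge_min lexx orbT|lra].
have [Dn|Dp] := ltP D 0.
  have := H (- e); rewrite normrN gtr0_norm// => /(_ et).
  move: eD; rewrite ltr0_norm//; nra.
have := H e; rewrite gtr0_norm// => /(_ et).
by move: eD nD; rewrite ger0_norm//; nra.
Qed.

Lemma sum_cauchy_schwarz (R : realType) (I : finType) (f g : I -> R) :
  (\sum_i f i * g i) ^+ 2 <= (\sum_i f i ^+ 2) * \sum_i g i ^+ 2.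
Proof.
set L := \sum_i f i ^+ 2; set xx := \sum_i g i ^+ 2; set ax := \sum_i _.
have L0 : 0 <= L by apply: sumr_ge0 => i _; exact: sqr_ge0.
have H t : 0 <= t ^+ 2 * L - 2 * t * ax + xx.
  have -> : t ^+ 2 * L - 2 * t * ax + xx = \sum_i (t * f i - g i) ^+ 2.
    rewrite /L /ax /xx !mulr_sumr -sumrB -big_split/=.
    by apply: eq_bigr => i _; ring.
  by apply: sumr_ge0 => i _; exact: sqr_ge0.
have [L00|Ln] := eqVneq L 0.
  rewrite L00 mul0r.
  have [->|axn] := eqVneq ax 0; first by rewrite expr0n.
  have := H ((xx + 1) / (2 * ax)); rewrite L00 mulr0.
  have -> : 2 * ((xx + 1) / (2 * ax)) * ax = xx + 1.
    by field; rewrite axn.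
  lra.
have Lp : 0 < L by rewrite lt_neqAle eq_sym Ln.
have := H (ax / L).
have -> : (ax / L) ^+ 2 * L - 2 * (ax / L) * ax + xx = (L * xx - ax ^+ 2) / L.
  by field.
by rewrite pmulr_lge0 ?invr_gt0// subr_ge0.
Qed.

Section gram_matrix.
Context {R : realType} {p n : nat} (V : 'I_p -> 'I_n -> R) (L : R).
Hypothesis L0 : 0 <= L.
Hypothesis V_bd : forall x : 'I_n -> R,
  \sum_b (\sum_j V b j * x j) ^+ 2 <= L * \sum_j x j ^+ 2.

Lemma quadratic_form_gram c x :
  quadratic_form (fun i j => c * \sum_b V b i * V b j) x
    = c * \sum_b (\sum_j V b j * x j) ^+ 2.
Proof.
rewrite /quadratic_form mulr_sumr.
under [RHS]eq_bigr => b _ do rewrite expr2 mulr_suml mulr_sumr.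
rewrite [RHS]exchange_big/=; apply: eq_bigr => i _.
under [RHS]eq_bigr => b _ do rewrite !mulr_sumr.
rewrite [RHS]exchange_big/=; apply: eq_bigr => j _.
rewrite mulr_sumr !mulr_suml; apply: eq_bigr => b _; ring.
Qed.

(** Test [V_bd] on the row itself and keep one term: the squared norm [r] satisfies
    [r^2 <= L * r]. *)
Lemma sum_sqr_row_le b : \sum_j V b j ^+ 2 <= L.
Proof.
set r := \sum_j _.
have r0 : 0 <= r by apply: sumr_ge0 => j _; exact: sqr_ge0.
have H : r ^+ 2 <= L * r.
  apply: le_trans (V_bd (V b)).
  rewrite (bigD1 b)//= lerDl; apply: sumr_ge0 => ? _; exact: sqr_ge0.
have [->//|rn] := eqVneq r 0.
by rewrite -(ler_pM2r (_ : 0 < r)) -?expr2// lt_neqAle eq_sym rn.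
Qed.

(* The Gram matrices V^T V and V V^T have the same Frobenius norm. *)
Lemma sum_sqr_gram_le :
  \sum_i \sum_j (\sum_b V b i * V b j) ^+ 2 <= L * \sum_b \sum_j V b j ^+ 2.
Proof.
have -> : \sum_i \sum_j (\sum_b V b i * V b j) ^+ 2 =
    \sum_b \sum_b' (\sum_j V b j * V b' j) ^+ 2.
  transitivity (\sum_i \sum_j \sum_b \sum_b' V b i * V b j * (V b' i * V b' j)).
    apply: eq_bigr => i _; apply: eq_bigr => j _.
    rewrite expr2 mulr_suml; apply: eq_bigr => b _.
    by rewrite mulr_sumr.
  transitivity (\sum_b \sum_b' \sum_i \sum_j V b i * V b j * (V b' i * V b' j)).
    under eq_bigr => i _ do rewrite exchange_big/=.
    rewrite exchange_big/=; apply: eq_bigr => b _.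
    under eq_bigr => i _ do rewrite exchange_big/=.
    by rewrite exchange_big.
  apply: eq_bigr => b _; apply: eq_bigr => b' _.
  rewrite expr2 mulr_suml; apply: eq_bigr => i _.
  by rewrite mulr_sumr; apply: eq_bigr => j _; ring.
rewrite mulr_sumr; apply: ler_sum => b _.
apply: le_trans (V_bd (V b)); apply: ler_sum => b' _.
rewrite le_eqVlt; apply/predU1P; left; congr (_ ^+ 2).
by apply: eq_bigr => j _; rewrite mulrC.
Qed.

End gram_matrix.

Section energy.
Context d (T : measurableType d) (R : realType) (Pr : probability T R).
Context (n : nat) (X : 'I_n -> {RV Pr >-> R}).
Hypothesis X_indep : mutually_independent Pr X.
Hypothesis X_mgf : forall i, mgf_subgaussian Pr (X i).

(** Hanson-Wright for the matrix [2 * l] times the Gram matrix of the columns, the 2 offsetting the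
    halved exponent there. The range of [l] gives the form bound 1/8, and 40 is 10 * 2^2. *)
Lemma energy_mgf p (V : 'I_p -> 'I_n -> R) (L l : R) :
  (forall x : 'I_n -> R,
    \sum_b (\sum_j V b j * x j) ^+ 2 <= L * \sum_j x j ^+ 2) ->
  `|l| * L <= 1 / 16 ->
  (\int[Pr]_w (expR (l * (\sum_b (\sum_j V b j * X j w) ^+ 2
      - \sum_b \sum_j second_moment (X j) * V b j ^+ 2)))%:E
   <= (expR (40 * l ^+ 2 * (L * \sum_b \sum_j V b j ^+ 2)))%:E)%E.
Proof.
move=> V_bd lL.
pose K i j := 2 * l * \sum_b V b i * V b j.
have K_sym i j : K i j = K j i.
  by congr (_ * _); apply: eq_bigr => b _; rewrite mulrC.
have K_bd x : `|quadratic_form K x| <= 1 / 8 * \sum_i x i ^+ 2.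
  rewrite quadratic_form_gram normrM [`|\sum_b _|]ger0_norm; last first.
    by apply: sumr_ge0 => b _; exact: sqr_ge0.
  apply: le_trans (ler_wpM2l (normr_ge0 _) (V_bd x)) _.
  rewrite mulrA ler_wpM2r//.
    by apply: sumr_ge0 => b _; exact: sqr_ge0.
  rewrite normrM ger0_norm//; lra.
have := hanson_wright_mgf X_indep X_mgf K_sym K_bd.
have E w : (quadratic_form K (fun i => X i w)
      - \sum_i second_moment (X i) * K i i) / 2 =
    l * (\sum_b (\sum_j V b j * X j w) ^+ 2
      - \sum_b \sum_j second_moment (X j) * V b j ^+ 2).
  rewrite quadratic_form_gram.
  have -> : \sum_i second_moment (X i) * K i i =
      2 * l * \sum_b \sum_j second_moment (X j) * V b j ^+ 2.
    rewrite exchange_big mulr_sumr; apply: eq_bigr => i _.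
    rewrite /K !mulr_sumr; apply: eq_bigr => b _; ring.
  by field.
under eq_integral do rewrite E.
move=> /le_trans; apply; rewrite lee_fin ler_expR.
have -> : \sum_i \sum_j K i j ^+ 2 =
    4 * l ^+ 2 * \sum_i \sum_j (\sum_b V b i * V b j) ^+ 2.
  rewrite mulr_sumr; apply: eq_bigr => i _; rewrite mulr_sumr.
  by apply: eq_bigr => j _; rewrite exprMn exprMn; ring.
have -> : 40 * l ^+ 2 * (L * \sum_b \sum_j V b j ^+ 2) =
   10 * (4 * l ^+ 2 * (L * \sum_b \sum_j V b j ^+ 2)) by ring.
rewrite ler_wpM2l// ler_wpM2l//; first by rewrite mulr_ge0// sqr_ge0.
exact: sum_sqr_gram_le.
Qed.

(* The exponential moment bound at parameters of both signs pins down the mean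
   of the square. *)
Lemma second_moment_linear (a : 'I_n -> R) (c : R) :
  (\int[Pr]_w ((\sum_j a j * X j w) ^+ 2)%:E = c%:E)%E ->
  \sum_j second_moment (X j) * a j ^+ 2 = c.
Proof.
move=> hc; set sg := \sum_j _.
pose L := \sum_j a j ^+ 2.
have L0 : 0 <= L by apply: sumr_ge0 => j _; exact: sqr_ge0.
pose h w := (\sum_j a j * X j w) ^+ 2.
have mh : measurable_fun setT h.
  apply: measurable_funX; apply: measurable_sum => j; exact: measurable_funM.
have ih : Pr.-integrable setT (EFin \o h).
  apply/integrableP; split; first exact/measurable_EFinP.
  under eq_integral do rewrite /= ger0_norm ?sqr_ge0//.
  by rewrite hc ltry.
have V_bd (x : 'I_n -> R) : \sum_(b < 1) (\sum_j a j * x j) ^+ 2 <= L * \sum_j x j ^+ 2.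
  by rewrite big_ord1; exact: sum_cauchy_schwarz.
apply/esym/eqP; rewrite -subr_eq0; apply/eqP.
(* Small enough for [energy_mgf], which needs [|t| * L <= 1/16], and for y = 40 L^2 t^2 <= 3/8. Then
   exp y <= 1 + y + y^2 <= 1 + 2 y, the origin of 80. *)
pose t0 := 1 / (32 * (L ^+ 2 + 1)).
have L21 : 0 < 32 * (L ^+ 2 + 1) by have := sqr_ge0 L; lra.
have t00 : 0 < t0 by rewrite divr_gt0.
apply: (@linear_le_quadratic_eq0 _ _ (80 * L ^+ 2) t0) => //.
  by rewrite mulr_ge0// sqr_ge0.
move=> t tt0.
have t0L : t0 * (32 * (L ^+ 2 + 1)) = 1 by rewrite divfK// gt_eqF.
have tL : `|t| * L <= 1 / 16.
  apply: (@le_trans _ _ (t0 * L)); first by rewrite ler_wpM2r.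
  have : L <= L ^+ 2 + 1 by have := sqr_ge0 (L - 1); lra.
  nra.
have := energy_mgf V_bd tL.
under eq_integral => w _ do rewrite !big_ord1 -/sg -/(h w).
rewrite big_ord1 -/L.
have linE : (fun w => (1 + t * (h w - sg))%:E) =
    (fun w => (1 - t * sg)%:E + t%:E * (h w)%:E)%E.
  by apply/funext => w; rewrite -EFinM -EFinD; congr (_%:E); ring.
have E : (\int[Pr]_w (1 + t * (h w - sg))%:E = (1 + t * (c - sg))%:E)%E.
  rewrite linE.
  rewrite integralD//; last 2 first.
  - exact: finite_measure_integrable_cst.
  - exact: integrableZl.
  rewrite integral_cst//= probability_setT mule1 integralZl// hc -EFinM -EFinD.
  by congr (_%:E); ring.
move=> H.
have iE : Pr.-integrable setT (fun w => (expR (t * (h w - sg)))%:E).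
  apply/integrableP; split.
    apply/measurable_EFinP; apply: measurableT_comp => //.
    by apply: measurable_funM => //; exact: measurable_funB.
  under eq_integral do rewrite /= ger0_norm ?expR_ge0//.
  by rewrite (le_lt_trans H)// ltry.
have : ((1 + t * (c - sg))%:E <= (expR (40 * t ^+ 2 * (L * L)))%:E)%E.
  rewrite -E; apply: le_trans H; apply: le_integral => //; last first.
    by move=> w _; rewrite lee_fin expR_ge1Dx.
  rewrite linE; apply: integrableD => //.
  - exact: finite_measure_integrable_cst.
  - exact: integrableZl.
rewrite lee_fin => {}H.
have yE : 40 * t ^+ 2 * (L * L) = 40 * L ^+ 2 * t ^+ 2 by ring.
have y0 : 0 <= 40 * L ^+ 2 * t ^+ 2 by have := mulr_ge0 (sqr_ge0 L) (sqr_ge0 t); nra.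
have y1 : 40 * L ^+ 2 * t ^+ 2 <= 3 / 8.
  have : t ^+ 2 <= t0 ^+ 2.
    by rewrite -(real_normK (num_real t)) lerXn2r ?nnegrE// ltW.
  have : t0 * L ^+ 2 <= 1 / 32 by have := sqr_ge0 L; nra.
  have : t0 <= 1 / 32 by have := sqr_ge0 L; nra.
  have := sqr_ge0 L; nra.
rewrite yE in H.
have := expR_le_quadratic1 (_ : `|40 * L ^+ 2 * t ^+ 2| <= 3 / 8).
rewrite ger0_norm// => /(_ y1); nra.
Qed.

End energy.

(** * Euclidean, operator and Frobenius norms *)

Section euclidean_operator_norms.
Context {R : realType}.

Lemma sqrt_sum_sqrD (I : finType) (f g : I -> R) :
  Num.sqrt (\sum_i (f i + g i) ^+ 2)
    <= Num.sqrt (\sum_i f i ^+ 2) + Num.sqrt (\sum_i g i ^+ 2).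
Proof.
have f0 : 0 <= \sum_i f i ^+ 2 by apply: sumr_ge0 => i _; exact: sqr_ge0.
have g0 : 0 <= \sum_i g i ^+ 2 by apply: sumr_ge0 => i _; exact: sqr_ge0.
rewrite -[leRHS]ger0_norm ?addr_ge0 ?sqrtr_ge0// -sqrtr_sqr ler_wsqrtr//.
rewrite sqrrD !sqr_sqrtr//.
have -> : \sum_i (f i + g i) ^+ 2 = \sum_i f i ^+ 2 + 2 * (\sum_i f i * g i)
    + \sum_i g i ^+ 2.
  by rewrite mulr_sumr -!big_split/=; apply: eq_bigr => i _; ring.
rewrite lerD2r lerD2l -[X in _ <= X]mulr_natl ler_wpM2l// -sqrtrM//.
apply: le_trans (ler_norm _) _; rewrite -sqrtr_sqr ler_wsqrtr//.
exact: sum_cauchy_schwarz.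
Qed.

Lemma sqrt_sum_sqrZ (I : finType) (c : R) (f : I -> R) : 0 <= c ->
  Num.sqrt (\sum_i (c * f i) ^+ 2) = c * Num.sqrt (\sum_i f i ^+ 2).
Proof.
move=> c0; under eq_bigr do rewrite exprMn.
by rewrite -mulr_sumr sqrtrM ?sqr_ge0// sqrtr_sqr ger0_norm.
Qed.

Lemma euclidean_norm_mulmx_frobenius m n (A : 'M[R]_(m, n)) (x : 'cV[R]_n) :
  euclidean_norm (A *m x) <= frobenius_norm A * euclidean_norm x.
Proof.
rewrite /euclidean_norm /frobenius_norm -sqrtrM; last first.
  by apply: sumr_ge0 => i _; apply: sumr_ge0 => j _; exact: sqr_ge0.
apply: ler_wsqrtr; rewrite mulr_suml; apply: ler_sum => i _.
by rewrite mxE; exact: sum_cauchy_schwarz.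
Qed.

(** The supremum is meaningful only for a bounded set; the Frobenius norm is a bound. *)
Lemma operator_norm_ub m n (A : 'M[R]_(m, n)) (x : 'cV[R]_n) :
  euclidean_norm x <= 1 -> euclidean_norm (A *m x) <= operator_norm A.
Proof.
move=> x1; apply: sup_upper_bound; last by exists x.
split; first by exists (euclidean_norm (A *m x)), x.
exists (frobenius_norm A) => _ [y /= y1 <-].
apply: le_trans (euclidean_norm_mulmx_frobenius _ _) _.
by rewrite ler_piMr// sqrtr_ge0.
Qed.

Lemma operator_norm_ge0 m n (A : 'M[R]_(m, n)) : 0 <= operator_norm A.
Proof.
have z p : euclidean_norm (0 : 'cV[R]_p) = 0.
  by rewrite /euclidean_norm big1 ?sqrtr0// => i _; rewrite mxE expr0n.
by have := @operator_norm_ub _ _ A 0; rewrite mulmx0 !z; apply.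
Qed.

Lemma euclidean_norm_mulmx_le m n (A : 'M[R]_(m, n)) (x : 'cV[R]_n) :
  euclidean_norm (A *m x) <= operator_norm A * euclidean_norm x.
Proof.
have normZ p c (y : 'cV[R]_p) : 0 <= c ->
    euclidean_norm (c *: y) = c * euclidean_norm y.
  move=> c0; rewrite /euclidean_norm -sqrt_sum_sqrZ//.
  by congr Num.sqrt; apply: eq_bigr => i _; rewrite mxE.
have [x0|xn] := eqVneq (euclidean_norm x) 0.
  apply: le_trans (euclidean_norm_mulmx_frobenius _ _) _.
  by rewrite x0 !mulr0.
have xp : 0 < euclidean_norm x by rewrite lt_neqAle eq_sym xn sqrtr_ge0.
rewrite -ler_pdivrMr// mulrC -normZ ?invr_ge0 ?(ltW xp)// scalemxAr.
by apply: operator_norm_ub; rewrite normZ ?invr_ge0 ?(ltW xp)// mulVf.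
Qed.

End euclidean_operator_norms.

(** * Measurable extension of the outer function *)

Section increment_extension.
Context {R : realType} (D0 : set R) (F0 Phi : R -> R).
Hypothesis Phi_majorant : increment_majorant D0 F0 Phi.

(* The infimum over all u > 2 |z - y| makes the extension upper semicontinuous;
   the factor 2 makes the balls around z large enough for the increment bound
   on D0 to give lower bounds although Phi need not be subadditive. *)
Definition increment_extension (z : R) : R :=
  inf [set v | exists y u, [/\ D0 y, 2 * `|z - y| < u & v = F0 y + Phi u]].

Let majorant_homo x y : 0 <= x -> x <= y -> Phi x <= Phi y.
Proof.
move=> x0; rewrite le_eqVlt => /predU1P[->//|xy].
by rewrite ltW// (majorant_incr Phi_majorant).
Qed.

(** Since |y - y'| < (u + u')/2, the larger of [u] and [u'] exceeds the distance, and [Phi] at that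
    single point bounds the increment. *)
Let lower z y u y' u' : D0 y -> D0 y' -> 2 * `|z - y| < u ->
  2 * `|z - y'| < u' -> F0 y - Phi u <= F0 y' + Phi u'.
Proof.
move=> Dy Dy' yu yu'.
have n1 := normr_ge0 (z - y); have n2 := normr_ge0 (z - y').
have H : `|y - y'| <= `|z - y| + `|z - y'|.
  have -> : y - y' = (z - y') - (z - y) by ring.
  by rewrite [leRHS]addrC ler_normB.
have Pu := majorant_ge0 Phi_majorant (_ : 0 <= u).
have Pu' := majorant_ge0 Phi_majorant (_ : 0 <= u').
have := majorant_le Phi_majorant Dy Dy'.
rewrite ler_norml => /andP[_ HF].
have [uu|uu] := leP u u'.
  have : Phi `|y - y'| <= Phi u' by apply: majorant_homo => //; lra.
  have := Pu ltac:(lra); lra.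
have : Phi `|y - y'| <= Phi u by apply: majorant_homo => //; lra.
have := Pu' ltac:(lra); lra.
Qed.

Lemma increment_extension_le y z u : D0 y -> 2 * `|z - y| < u ->
  `|increment_extension z - F0 y| <= Phi u.
Proof.
move=> Dy yu; rewrite ler_distl; apply/andP; split.
  apply: lb_le_inf; first by exists (F0 y + Phi u), y, u.
  by move=> _ [y' [u' [Dy' yu' ->]]]; exact: (lower Dy Dy' yu yu').
apply: ge_inf; last by exists y, u.
exists (F0 y - Phi u) => _ [y' [u' [Dy' yu' ->]]].
exact: (lower Dy Dy' yu yu').
Qed.

(** Strictness comes from the midpoint of [2 * |z - y|] and [t]. An error of at least [Phi t]
    therefore forces a deviation of at least [t / 2]. *)
Lemma increment_extension_lt y z t : D0 y -> 2 * `|z - y| < t ->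
  `|increment_extension z - F0 y| < Phi t.
Proof.
move=> Dy yt; have n1 := normr_ge0 (z - y).
apply: (@le_lt_trans _ _ (Phi ((2 * `|z - y| + t) / 2))).
  by apply: increment_extension_le => //; lra.
by apply: (majorant_incr Phi_majorant); lra.
Qed.

Lemma measurable_increment_extension : measurable_fun setT increment_extension.
Proof.
have [D00|/set0P[y0 Dy0]] := eqVneq D0 set0.
  rewrite (_ : increment_extension = cst 0)//; apply/funext => z.
  rewrite /increment_extension (_ : mkset _ = set0) ?inf0//.
  by apply/seteqP; split=> // v [y [u []]]; rewrite D00.
apply: (measurability (@RGenInftyO.G R)); first exact: RGenInftyO.measurableE.
move=> _ [_ [c ->] <-]; apply: open_measurable; rewrite setTI.
rewrite openE => z /=; rewrite in_itv/= => zc.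
have [|_ [y [u [Dy yu ->]]] vc] := inf_lt _ zc.
  by exists (F0 y0 + Phi (2 * `|z - y0| + 1)), y0, (2 * `|z - y0| + 1); split => //; lra.
(* Within this radius the same pair [y], [u] remains admissible, so strict sublevel sets are
   open. *)
apply/nbhs_ballP; exists ((u - 2 * `|z - y|) / 2) => /=; first by lra.
move=> z' /=; rewrite /ball/= => zz'.
rewrite in_itv/=; apply: le_lt_trans vc; apply: ge_inf; last first.
  exists y, u; split=> //.
  have : `|z' - y| <= `|z - z'| + `|z - y|.
    rewrite (_ : z' - y = (z - y) - (z - z')); last by ring.
    by rewrite [leRHS]addrC ler_normB.
  lra.
exists (F0 y0 - Phi (2 * `|z' - y0| + 1)) => _ [y' [u' [Dy' yu' ->]]].
by apply: (lower Dy0 Dy' _ yu'); lra.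
Qed.

End increment_extension.

(** * Concentration of the energy under random signs *)

Section two_sided_chernoff.
Context d (T : measurableType d) (R : realType) (Pr : probability T R).

Lemma chernoff_abs (Y : {RV Pr >-> R}) (l a : R) : 0 < l ->
  (Pr [set w | a <= `|Y w|]%R <= (expR (- (l * a)))%:E *
    (\int[Pr]_w (expR (l * Y w))%:E + \int[Pr]_w (expR (- l * Y w))%:E))%E.
Proof.
move=> l0.
have one (Z : {RV Pr >-> R}) : (Pr [set w | a <= Z w]%R <=
    (expR (- (l * a)))%:E * \int[Pr]_w (expR (l * Z w))%:E)%E.
  apply: le_trans (chernoff Z a l0) _.
  rewrite muleC /mmt_gen_fun unlock le_eqVlt; apply/predU1P; left; congr (_ * _)%E.
  by apply: eq_integral => w _ /=; rewrite mulrC.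
have mset (Z : {RV Pr >-> R}) : measurable [set w | a <= Z w].
  have := @measurable_funPT _ _ _ _ Z measurableT _ (measurable_itv `[a, +oo[).
  rewrite setTI; congr measurable.
  by apply/seteqP; split => w /=; rewrite in_itv/= andbT.
rewrite muleDr//; last first.
  by rewrite ge0_adde_def// inE; apply: integral_ge0 => w _; rewrite lee_fin expR_ge0.
have := one Y; have := one (- Y)%R => H1 H2.
apply: le_trans (_ : _ <= Pr ([set w | a <= Y w]%R `|` [set w | a <= (- Y) w]%R))%E _.
  apply: le_measure; rewrite ?inE//.
  - rewrite (_ : mkset _ = [set w | a <= Y w] `|` [set w | a <= (- Y) w]).
      by apply: measurableU; exact: mset.
    apply/seteqP; split => w /=; rewrite ler_normr => /orP[]; rewrite ?fctE; tauto.
  - by apply: measurableU; exact: mset.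
  by move=> w /=; rewrite ler_normr => /orP[]; tauto.
apply: le_trans (measureU2 _ _ _) _; [exact: mset|exact: mset|].
apply: leeD; first exact: H2.
apply: le_trans H1 _; rewrite le_eqVlt; apply/predU1P; left; congr (_ * _)%E.
by apply: eq_integral => w _; rewrite mulrN mulNr.
Qed.

End two_sided_chernoff.

Section randomized_energy.
Context d (T : measurableType d) (R : realType) (Pr : probability T R).
Context (n p M : nat) (C : finType) (X : 'I_n -> {RV Pr >-> R}).
Hypothesis X_indep : mutually_independent Pr X.
Hypothesis X_mgf : forall i, mgf_subgaussian Pr (X i).
Context (h : 'I_p -> 'I_M) (v : 'I_p -> C -> 'I_n -> R) (L g ET : R).
Let V (u : {ffun 'I_M -> C}) b j := v b (u (h b)) j.
Let energy u w := \sum_b (\sum_j V u b j * X j w) ^+ 2.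
Hypothesis h_card : forall m, (#|[pred b | h b == m]| <= 2)%N.
Hypothesis C_gt0 : (0 < #|C|)%N.
Hypothesis L0 : 0 <= L.
Hypothesis V_bd : forall u (x : 'I_n -> R),
  \sum_b (\sum_j V u b j * x j) ^+ 2 <= L * \sum_j x j ^+ 2.
Hypothesis V_frob : forall u, \sum_b \sum_j V u b j ^+ 2 <= g.
Hypothesis ET_def :
  #|C|%:R * ET = \sum_b \sum_c \sum_j second_moment (X j) * v b c j ^+ 2.

Let N : R := #|{ffun 'I_M -> C}|%:R.

(** The conditional mean energy of channel use [m] when its signs are [c]. *)
Let weight m c : R :=
  \sum_(b | h b == m) \sum_j second_moment (X j) * v b c j ^+ 2.

Let sm_le (y : 'I_n -> R) :
  0 <= \sum_j second_moment (X j) * y j ^+ 2 <= 8 / 3 * \sum_j y j ^+ 2.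
Proof.
apply/andP; split.
  by apply: sumr_ge0 => j _; rewrite mulr_ge0 ?sqr_ge0 ?second_moment_ge0.
rewrite mulr_sumr; apply: ler_sum => j _.
by rewrite ler_wpM2r ?sqr_ge0// second_moment_le.
Qed.

(** Two real coordinates, each with a row of squared norm at most [L] and second moments at most
    8/3. A constant pattern realises any given [c] at every row. *)
Let weight_bd m c : 0 <= weight m c <= 16 / 3 * L.
Proof.
apply/andP; split.
  by apply: sumr_ge0 => b _; have /andP[] := sm_le (v b c).
apply: (@le_trans _ _ (\sum_(b | h b == m) (8 / 3 * L))).
  apply: ler_sum => b _; have /andP[_ H] := sm_le (v b c).
  apply: le_trans H _; rewrite ler_wpM2l//.
  have := sum_sqr_row_le L0 (V_bd [ffun=> c]) b.
  by apply: le_trans; apply: ler_sum => j _; rewrite /V ffunE.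
rewrite sumr_const -[X in X <= _]mulr_natl.
have -> : 16 / 3 * L = 2 * (8 / 3 * L) by lra.
by rewrite ler_wpM2r ?mulr_ge0// ler_nat; exact: h_card.
Qed.

Let ET_weight : #|C|%:R * ET = \sum_m \sum_c weight m c.
Proof.
rewrite ET_def (partition_big h xpredT)//=; apply: eq_bigr => m _.
by rewrite exchange_big.
Qed.

Let ET_le : ET <= 8 / 3 * g.
Proof.
have C0 : 0 < #|C|%:R :> R by rewrite ltr0n.
rewrite -(ler_pM2l C0) ET_def exchange_big/=.
apply: (@le_trans _ _ (\sum_(c : C) (8 / 3 * g))); last first.
  by rewrite sumr_const -[X in X <= _]mulr_natl.
apply: ler_sum => c _; apply: (@le_trans _ _ (8 / 3 * \sum_b \sum_j v b c j ^+ 2)).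
  by rewrite mulr_sumr; apply: ler_sum => b _; have /andP[] := sm_le (v b c).
rewrite ler_wpM2l//; apply: le_trans (V_frob [ffun=> c]).
by apply: ler_sum => b _; apply: ler_sum => j _; rewrite /V ffunE.
Qed.

Let g0 : 0 <= g.
Proof.
have C0 := C_gt0.
have [c _] : exists c : C, true by move/card_gt0P: C0 => [c _]; exists c.
apply: le_trans (V_frob [ffun=> c]).
by apply: sumr_ge0 => b _; apply: sumr_ge0 => j _; exact: sqr_ge0.
Qed.

Lemma measurable_energy u : measurable_fun setT (energy u).
Proof.
apply: measurable_sum => b; apply: measurable_funX; apply: measurable_sum => j.
exact: measurable_funM.
Qed.

(** Split the deviation at the conditional mean [Tu]. The inner part costs 40; the outer one costs
    (16/3 L) * ET with [ET <= 8/3 * g], and its range condition reads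
    [|l| * (16/3 * L) <= 1/3 <= 3/8]. *)
Lemma randomized_energy_mgf (l : R) : `|l| * L <= 1 / 16 ->
  (\sum_u \int[Pr]_w (expR (l * (energy u w - ET)))%:E
   <= (N * expR (64 * l ^+ 2 * (L * g)))%:E)%E.
Proof.
move=> lL.
pose Tu (u : {ffun 'I_M -> C}) := \sum_m weight m (u m).
have TuE u : Tu u = \sum_b \sum_j second_moment (X j) * V u b j ^+ 2.
  rewrite (partition_big h xpredT)//=; apply: eq_bigr => m _.
  by apply: eq_bigr => b /eqP <-.
have one u : (\int[Pr]_w (expR (l * (energy u w - ET)))%:E <=
    (expR (40 * l ^+ 2 * (L * g)) * expR (l * (Tu u - ET)))%:E)%E.
  have E w : expR (l * (energy u w - ET)) =
      expR (l * (Tu u - ET)) * expR (l * (energy u w - Tu u)).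
    by rewrite -expRD; congr expR; ring.
  under eq_integral do rewrite E EFinM.
  rewrite ge0_integralZl//; last first.
    apply/measurable_EFinP; apply: measurableT_comp => //.
    by apply: measurable_funM => //; apply: measurable_funB => //;
      exact: measurable_energy.
  rewrite [X in (_ <= X%:E)%E]mulrC EFinM; apply: lee_wpmul2l; first by rewrite lee_fin expR_ge0.
  have := energy_mgf X_indep X_mgf (V_bd u) lL; rewrite -TuE.
  move=> /le_trans; apply; rewrite lee_fin ler_expR.
  rewrite ler_wpM2l//; first by rewrite mulr_ge0// sqr_ge0.
  by rewrite ler_wpM2l.
apply: le_trans (lee_sum _ (fun u _ => one u)) _.
rewrite sumEFin lee_fin -mulr_sumr.
have lb : `|l| * (16 / 3 * L) <= 3 / 8 by lra.
have H := sum_expR_independent_le weight_bd lb ET_weight C_gt0.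
apply: le_trans (ler_wpM2l (expR_ge0 _) H) _.
rewrite mulrCA -expRD ler_wpM2l ?ler0n// ler_expR.
have l2 := sqr_ge0 l.
have : l ^+ 2 * L * ET <= l ^+ 2 * L * (8 / 3 * g) by rewrite ler_wpM2l// mulr_ge0.
have : 0 <= l ^+ 2 * L * g by exact: mulr_ge0 (mulr_ge0 l2 L0) g0.
lra.
Qed.

Lemma randomized_energy_tail (x : R) : 0 < x -> 0 < L ->
  (\sum_u Pr [set w | x <= `|energy u w - ET|]%R
   <= (N * (2 * expR (- (x ^+ 2 / (256 * (L * g) + 32 * x * L)))))%:E)%E.
Proof.
move=> x0 L1.
(* Half the final denominator. The term [16 * x * L] keeps [l = x / den] in range, and
   [128 * (L * g)] makes the moment term at most [l * x / 2], half of the Chernoff gain. *)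
pose den := 128 * (L * g) + 16 * x * L.
have Lg0 : 0 <= L * g by rewrite mulr_ge0.
have xL : 0 < x * L by rewrite mulr_gt0.
have den0 : 0 < den by rewrite /den; lra.
pose l := x / den.
have l0 : 0 < l by rewrite divr_gt0.
have lden : l * den = x by rewrite /l divfK// gt_eqF.
have lL : `|l| * L <= 1 / 16.
  rewrite gtr0_norm//; have : l * den * L = x * L by rewrite lden.
  rewrite /den; nra.
have one u : (Pr [set w | x <= `|energy u w - ET|]%R <= (expR (- (l * x)))%:E *
    (\int[Pr]_w (expR (l * (energy u w - ET)))%:E
     + \int[Pr]_w (expR (- l * (energy u w - ET)))%:E))%E.
  have mY : measurable_fun setT (fun w => energy u w - ET).
    by apply: measurable_funB => //; exact: measurable_energy.
  exact: (chernoff_abs (mfun_Sub (mem_set mY)) x l0).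
apply: le_trans (lee_sum _ (fun u _ => one u)) _.
rewrite -ge0_sume_distrr; last first.
  by move=> u _; apply: adde_ge0; apply: integral_ge0 => w _; rewrite lee_fin expR_ge0.
rewrite big_split/=.
have H1 := randomized_energy_mgf lL.
have H2 : `|- l| * L <= 1 / 16 by rewrite normrN.
have {}H2 := randomized_energy_mgf H2.
apply: le_trans.
  by apply: lee_wpmul2l; [rewrite lee_fin expR_ge0|exact: (leeD H1 H2)].
rewrite -EFinD -EFinM lee_fin sqrrN.
set E := expR (64 * l ^+ 2 * (L * g)).
apply: (@le_trans _ _ (N * (2 * (expR (- (l * x)) * E)))).
  by rewrite le_eqVlt; apply/predU1P; left; ring.
rewrite ler_wpM2l ?ler0n// ler_wpM2l// -expRD ler_expR.
have -> : 256 * (L * g) + 32 * x * L = 2 * den by rewrite /den; ring.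
have -> : x ^+ 2 / (2 * den) = l * x / 2.
  by rewrite /l; field; rewrite gt_eqF.
have : l ^+ 2 * den = l * x by rewrite expr2 -mulrA lden.
have : 0 <= l ^+ 2 * (x * L) by rewrite mulr_ge0 ?sqr_ge0// ltW.
rewrite /den; lra.
Qed.

End randomized_energy.

(** * Measurability over the complex numbers and the uniform law of the signs *)

Section complex_measurability.
Context {R : realType}.

Lemma measurable_complexP d (T : measurableType d) (f : T -> R[i]) :
  measurable_fun setT (fun w => complex.Re (f w)) ->
  measurable_fun setT (fun w => complex.Im (f w)) -> measurable_fun setT f.
Proof.
move=> mRe mIm _ _ [B mB <-].
have H : measurable_fun setT (fun w => (complex.Re (f w), complex.Im (f w))).
  exact: measurable_fun_pair.
by have := H measurableT B mB; rewrite !setTI.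
Qed.

Let measurable_pair (B : set (R * R)) : measurable B ->
  measurable [set z : R[i] | B (complex.Re z, complex.Im z)].
Proof. by move=> mB; exists B; rewrite ?setTI. Qed.

Lemma measurable_Re : measurable_fun setT (fun z : R[i] => complex.Re z).
Proof.
move=> _ A mA; rewrite setTI.
have := measurable_pair (measurableX mA (@measurableT _ R)).
by congr measurable; apply/seteqP; split => z /=; tauto.
Qed.

Lemma measurable_Im : measurable_fun setT (fun z : R[i] => complex.Im z).
Proof.
move=> _ A mA; rewrite setTI.
have := measurable_pair (measurableX (@measurableT _ R) mA).
by congr measurable; apply/seteqP; split => z /=; tauto.
Qed.

End complex_measurability.

Section uniform_nat.
Context (R : realType) (N : nat).

Let weight_ge0 : (0 : R) <= N.+1%:R^-1.
Proof. by rewrite invr_ge0 ler0n. Qed.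

(** It charges the [N + 1] points from 0 to [N]. On [nat] every set is measurable, so maps from
    indices to signs raise no measurability question. *)
Definition uniform_nat : set nat -> \bar R :=
  mscale (NngNum weight_ge0) (msum (fun k => \d_k) N.+1).

HB.instance Definition _ := Measure.on uniform_nat.

Let uniform_nat_setT : uniform_nat setT = 1%E.
Proof.
rewrite /uniform_nat/= /mscale/= /msum.
rewrite (eq_bigr (fun=> 1%:E)); last by move=> k _; rewrite /= diracT.
by rewrite sumEFin sumr_const card_ord -EFinM mulVf// pnatr_eq0.
Qed.

HB.instance Definition _ :=
  @Measure_isProbability.Build _ _ R uniform_nat uniform_nat_setT.

Lemma product_uniform_nat d (T : measurableType d) (Pr : probability T R)
    (E : set (T * nat)) : measurable E ->
  ((Pr \x uniform_nat) E = (N.+1%:R^-1)%:E * \sum_(k < N.+1) Pr (ysection E k))%E.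
Proof.
move=> mE.
have -> : ((Pr \x uniform_nat) E =
    \int[Pr]_x fubini_F uniform_nat (EFin \o \1_E) x)%E.
  by rewrite indic_fubini_tonelli_FE.
rewrite indic_fubini_tonelli//.
have mG := indic_measurable_fun_fubini_tonelli_G Pr mE.
have G0 := @indic_fubini_tonelli_G_ge0 _ _ _ _ _ Pr E.
transitivity ((N.+1%:R^-1)%:E * \int[msum (fun k => \d_k) N.+1]_y
    fubini_G Pr (EFin \o \1_E) y)%E.
  exact: (ge0_integral_mscale _ measurableT (NngNum weight_ge0) mG).
rewrite ge0_integral_measure_sum//; congr (_ * _)%E; apply: eq_bigr => k _.
rewrite integral_dirac// diracT mul1e.
by rewrite indic_fubini_tonelli_GE.
Qed.

Lemma measurable_prod_nat d (T : measurableType d) (E : set (T * nat)) :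
  (forall k, measurable [set w | E (w, k)]) -> measurable E.
Proof.
move=> mE.
rewrite (_ : E = \bigcup_k ([set w | E (w, k)] `*` [set k])); last first.
  apply/seteqP; split => [[w k] Ewk|[w k] [k' _ [/= + ->]]] //=.
  by exists k.
by apply: bigcupT_measurable => k; apply: measurableX.
Qed.

End uniform_nat.

(** * Centring of the driving vector *)

Section centering.
Context d (T : measurableType d) (R : realType) (Pr : probability T R).

(** [fine] makes [mu] a real number before integrability is known. The moment bound for [X - mu]
    gives it a finite second moment, and |X| <= |mu| + 1 + (X - mu)^2. *)
Lemma subgaussian_integrable (X : {RV Pr >-> R}) : (subgaussian_norm Pr X <= 1)%E ->
  Pr.-integrable setT (EFin \o X).
Proof.
move=> X1; set mu := fine ('E_Pr[X])%E.
have mX : measurable_fun setT (fun w => X w - mu).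
  exact: measurable_funB.
pose Y : {RV Pr >-> R} := mfun_Sub (mem_set mX).
have Y_mgf : mgf_subgaussian Pr Y by exact: subgaussian_norm_mgf.
have iY := integrable_sqr Y_mgf.
apply: (@le_integrable _ _ _ _ _ measurableT _
  (fun w => (`|mu| + 1)%:E + (Y w ^+ 2)%:E)%E) => //.
- exact/measurable_EFinP.
- move=> w _ /=; rewrite lee_fin.
  rewrite [leRHS]ger0_norm; last by rewrite !addr_ge0// sqr_ge0.
  have -> : X w = Y w + mu by rewrite /Y/= subrK.
  apply: le_trans (ler_normD _ _) _.
  have := sqr_ge0 (`|Y w| - 1); have := real_normK (num_real (Y w)).
  have := normr_ge0 (Y w); nra.
- apply: integrableD => //; exact: finite_measure_integrable_cst.
Qed.

Lemma mutually_independent_shift n (X : 'I_n -> T -> R) (mu : 'I_n -> R) :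
  mutually_independent Pr X ->
  mutually_independent Pr (fun i w => X i w - mu i).
Proof.
move=> X_indep B mB.
have := X_indep (fun i => (fun x => x - mu i) @^-1` B i).
apply => i; rewrite -[X in measurable X]setTI.
have : measurable_fun setT (fun x : R => x - mu i) by exact: measurable_funB.
by apply.
Qed.

End centering.

(** * Norms of the matrix combining fading and noise *)

Section mixture_norms.
Context {R : realType} (p K n : nat).
Context (A : 'M[R]_(p * K, n)) (B : 'M[R]_(p, n)).
Context (q : 'I_p -> 'I_K -> R) (r S : R).
Hypothesis r0 : 0 <= r.
Hypothesis q_le : forall b, \sum_k q b k ^+ 2 <= S.

(** Row [b] of the matrix taking the driving vector to the received real coordinate [b]; [q] carries
    the signed amplitudes and [r] the scale of the noise. *)
Definition mixture b j := \sum_k q b k * A (mxvec_index b k) j + r * B b j.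

Lemma sum_mxvec_index (F : 'I_(p * K) -> R) :
  \sum_i F i = \sum_b \sum_k F (mxvec_index b k).
Proof.
rewrite pair_bigA (reindex _ (curry_mxvec_bij _ _)) /=.
by apply: eq_bigr => -[b k] _.
Qed.

Let S0 : (0 < p)%N -> 0 <= S.
Proof.
move=> p0; apply: le_trans (q_le (Ordinal p0)).
by apply: sumr_ge0 => k _; exact: sqr_ge0.
Qed.

Let block_le (b : 'I_p) (y : 'I_K -> R) :
  (\sum_k q b k * y k) ^+ 2 <= S * \sum_k y k ^+ 2.
Proof.
apply: le_trans (sum_cauchy_schwarz _ _) _; rewrite ler_wpM2r ?q_le//.
by apply: sumr_ge0 => k _; exact: sqr_ge0.
Qed.

Lemma mixture_mulmx (x : 'cV[R]_n) b : \sum_j mixture b j * x j 0 =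
  \sum_k q b k * (A *m x) (mxvec_index b k) 0 + r * (B *m x) b 0.
Proof.
under eq_bigr do rewrite mulrDl.
rewrite big_split/=; congr (_ + _).
  under eq_bigr do rewrite mulr_suml.
  rewrite exchange_big/=; apply: eq_bigr => k _.
  by rewrite mxE mulr_sumr; apply: eq_bigr => j _; rewrite mulrA.
by rewrite mxE mulr_sumr; apply: eq_bigr => j _; rewrite mulrA.
Qed.

(** Each weight vector [q b] acts on its own block of [A x], so Cauchy-Schwarz per block costs only
    [S] in total; the triangle inequality adds the noise. *)
Lemma mixture_operator_le (x : 'I_n -> R) :
  \sum_b (\sum_j mixture b j * x j) ^+ 2
    <= (Num.sqrt S * operator_norm A + r * operator_norm B) ^+ 2
       * \sum_j x j ^+ 2.
Proof.
(* Without rows [q_le] does not imply that [S] is nonnegative. *)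
have [p0|p0] := posnP p.
  rewrite big1; last by move=> b; have := ltn_ord b; rewrite {2}p0.
  by rewrite mulr_ge0 ?sqr_ge0//; apply: sumr_ge0 => j _; exact: sqr_ge0.
pose X : 'cV[R]_n := \col_j x j.
have XE : \sum_j x j ^+ 2 = euclidean_norm X ^+ 2.
  rewrite sqr_sqrtr; last by apply: sumr_ge0 => j _; exact: sqr_ge0.
  by apply: eq_bigr => j _; rewrite mxE.
have VE b : \sum_j mixture b j * x j =
    \sum_k q b k * (A *m X) (mxvec_index b k) 0 + r * (B *m X) b 0.
  by rewrite -mixture_mulmx; apply: eq_bigr => j _; rewrite mxE.
under eq_bigr do rewrite VE.
rewrite XE -exprMn -[leLHS]sqr_sqrtr; last first.
  by apply: sumr_ge0 => b _; exact: sqr_ge0.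
have op0 := operator_norm_ge0 A; have opB0 := operator_norm_ge0 B.
rewrite lerXn2r ?nnegrE ?sqrtr_ge0//.
  by rewrite mulr_ge0 ?sqrtr_ge0// addr_ge0// mulr_ge0 ?sqrtr_ge0.
apply: le_trans (sqrt_sum_sqrD _ _) _; rewrite mulrDl; apply: lerD; last first.
  by rewrite sqrt_sum_sqrZ// -mulrA ler_wpM2l//; exact: euclidean_norm_mulmx_le.
rewrite -mulrA; apply: le_trans (ler_wpM2l (sqrtr_ge0 S) (euclidean_norm_mulmx_le A X)).
rewrite -sqrtrM ?S0//; apply: ler_wsqrtr.
by rewrite sum_mxvec_index mulr_sumr; apply: ler_sum => b _; exact: block_le.
Qed.

Lemma mixture_frobenius_le :
  \sum_b \sum_j mixture b j ^+ 2
    <= (Num.sqrt S * frobenius_norm A + r * frobenius_norm B) ^+ 2.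
Proof.
have [p0|p0] := posnP p.
  rewrite big1 ?sqr_ge0// => b; have := ltn_ord b; by rewrite {2}p0.
rewrite pair_bigA/= -[leLHS]sqr_sqrtr; last first.
  by apply: sumr_ge0 => b _; exact: sqr_ge0.
rewrite lerXn2r ?nnegrE ?sqrtr_ge0//.
  by rewrite addr_ge0// mulr_ge0 ?sqrtr_ge0.
apply: le_trans (sqrt_sum_sqrD _ _) _; apply: lerD; last first.
  by rewrite sqrt_sum_sqrZ// -(pair_bigA _ (fun b j => B b j ^+ 2)).
rewrite -sqrtrM ?S0//; apply: ler_wsqrtr.
rewrite -(pair_bigA _ (fun b j => (\sum_k q b k * A (mxvec_index b k) j) ^+ 2))/=.
rewrite sum_mxvec_index mulr_sumr; apply: ler_sum => b _.
rewrite exchange_big mulr_sumr; apply: ler_sum => j _; exact: block_le.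
Qed.

End mixture_norms.

(** * Rows, real coordinates of the channel and spreads *)

Lemma sum_sqr_row_le_operator_norm (R : realType) m n (A : 'M[R]_(m, n)) i :
  \sum_j A i j ^+ 2 <= operator_norm A ^+ 2.
Proof.
apply: (@sum_sqr_row_le _ _ _ (fun i j => A i j)); first exact: sqr_ge0.
move=> x; pose X : 'cV[R]_n := \col_j x j.
have nE p (y : 'cV[R]_p) : euclidean_norm y ^+ 2 = \sum_j y j 0 ^+ 2.
  by rewrite sqr_sqrtr//; apply: sumr_ge0 => j _; exact: sqr_ge0.
have -> : \sum_j x j ^+ 2 = euclidean_norm X ^+ 2.
  by rewrite nE; apply: eq_bigr => j _; rewrite mxE.
have -> : \sum_b (\sum_j A b j * x j) ^+ 2 = euclidean_norm (A *m X) ^+ 2.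
  rewrite nE; apply: eq_bigr => b _; rewrite mxE; congr (_ ^+ 2).
  by apply: eq_bigr => j _; rewrite mxE.
rewrite -exprMn lerXn2r ?nnegrE ?sqrtr_ge0 ?mulr_ge0 ?sqrtr_ge0//.
  exact: operator_norm_ge0.
exact: euclidean_norm_mulmx_le.
Qed.

(** Parity is injective on the coordinates of one channel use. *)
Lemma card_half_ord M (m : 'I_M) :
  (#|[pred b : 'I_(2 * M) | half_ord b == m]| <= 2)%N.
Proof.
rewrite -[X in (_ <= X)%N]card_bool.
apply: (@leq_card_in _ _ (fun b : 'I_(2 * M) => odd b)).
move=> b b' /eqP hb /eqP hb' oo; apply/val_inj.
rewrite -[val b]odd_double_half -[val b']odd_double_half.
have := congr1 val hb; have := congr1 val hb'; rewrite /= => -> ->.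
by congr (_ + _)%N; congr nat_of_bool.
Qed.

Section channel_linearity.
Context {R : realType} {K M : nat}.

(** Real inputs do not mix the real and imaginary parts of the fading. *)
Lemma real_coord_channel_output (h : 'I_K -> 'I_M -> R[i]) (z : 'I_M -> R[i])
    (x : 'I_K -> 'I_M -> R) b :
  real_coord (fun m => tnth (channel_output h z (fun k m => real_complex R (x k m))) m) b
    = \sum_k x k (half_ord b) * real_coord (h k) b + real_coord z b.
Proof.
have ReD : {morph @complex.Re R : u v / u + v} by move=> [? ?] [? ?].
have ImD : {morph @complex.Im R : u v / u + v} by move=> [? ?] [? ?].
rewrite /real_coord tnth_mktuple; case: ifP => _.
  rewrite ImD (big_morph _ ImD (erefl _)); congr (_ + _).
  by apply: eq_bigr => k _; case: (h k _) => u v /=; ring.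
rewrite ReD (big_morph _ ReD (erefl _)); congr (_ + _).
by apply: eq_bigr => k _; case: (h k _) => u v /=; ring.
Qed.

Lemma fading_vectorE (h : 'I_K -> 'I_M -> R[i]) b k :
  fading_vector h (mxvec_index b k) 0 = real_coord (h k) b.
Proof. by rewrite mxE mxvecE mxE. Qed.

End channel_linearity.

Section spreads.
Context {R : realType} {K : nat} (S : 'I_K -> set R) (fk : 'I_K -> R -> R).
Hypothesis fk_bounded : forall k, [bounded fk k x | x in S k].

Let lower k : R := inf (fk k @` S k).

Lemma spread_bound k x : S k x -> 0 <= fk k x - lower k <= spread S fk k.
Proof.
move=> Sx; have [C [_ HC]] := fk_bounded k.
have fC y : S k y -> `|fk k y| <= C + 1 by apply: HC; lra.
have hi : has_ubound (fk k @` S k).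
  exists (C + 1) => _ [y Sy <-]; have := fC y Sy; rewrite ler_norml; lra.
have lo : has_lbound (fk k @` S k).
  exists (- (C + 1)) => _ [y Sy <-]; have := fC y Sy; rewrite ler_norml; lra.
have l1 : lower k <= fk k x by apply: ge_inf => //; exists x.
have l2 : fk k x <= sup (fk k @` S k) by apply: ub_le_sup => //; exists x.
by rewrite /spread -/(lower k); apply/andP; split; lra.
Qed.

Lemma spread_le_max k : spread S fk k <= max_spread S fk.
Proof. exact: le_bigmax. Qed.

Lemma max_spread_ge0 : 0 <= max_spread S fk.
Proof. exact: bigmax_ge_id. Qed.

End spreads.

(** * The scheme *)

Section dfa_scheme_construction.
Context {R : realType} {K M : nat} (P : R) (S : 'I_K -> set R).
Context (fk : 'I_K -> R -> R) (decode : R -> R) (noise_energy : R).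
Hypothesis P_gt0 : 0 < P.
Hypothesis S_closed : forall k, closed (S k).
Hypothesis fk_measurable : forall k, measurable_fun (S k) (fk k).
Hypothesis fk_bounded : forall k, [bounded fk k x | x in S k].
Hypothesis decode_measurable : measurable_fun setT decode.

(* All signs are drawn at once, as an index into the enumeration of patterns. *)
Definition sign_patterns := {ffun 'I_M -> {ffun 'I_K -> bool}}.

(** Indices beyond the enumeration are never drawn, but their default pattern also consists of unit
    signs, so the power constraint holds at every index. *)
Definition nth_pattern (i : nat) : sign_patterns :=
  nth [ffun=> [ffun=> false]] (enum {: sign_patterns}) i.

(** The predecessor appears because [uniform_nat R N] has [N + 1] atoms. *)
Definition pattern_law := uniform_nat R #|{: sign_patterns}|.-1.

Let sign k m (i : nat) : R := rademacher (nth_pattern i m) k.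

Let measurable_sign k m : measurable_fun setT (sign k m).
Proof. by []. Qed.

Definition rademacher_sign k m : {RV pattern_law >-> R} :=
  mfun_Sub (mem_set (measurable_sign k m)).

Let Dm := max_spread S fk.
Let lower k : R := inf (fk k @` S k).

(* If Dm = 0, then P / Dm = 0 and nothing is sent. *)
Definition amplitude k (s : R) : R :=
  Num.sqrt (P / Dm * ((fk k \_ (S k)) s - lower k)).

Definition encoder k (m : 'I_M) (s t : R) : R[i] :=
  real_complex R (amplitude k s * t).

Definition received_energy (y : M.-tuple R[i]) : R :=
  \sum_b real_coord (fun m => tnth y m) b ^+ 2.

(** Inverts the mean energy, which is [2 * M * (P / Dm)] times the sum of the values shifted by
    their infima, plus the noise energy. *)
Definition estimated_sum (e : R) : R :=
  Dm / (2 * M%:R * P) * (e - noise_energy) + \sum_k lower k.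

Definition decoder (y : M.-tuple R[i]) : R :=
  decode (estimated_sum (received_energy y)).

Let encoder_measurable k : measurable_fun (S k `*` [set: M.-tuple R])
  (fun p => [tuple encoder k m p.1 (tnth p.2 m) | m < M]).
Proof.
(* Closedness makes [S k] measurable, so [fk k] restricted to it, and with it the amplitude, is
   measurable on the whole line. *)
apply: measurable_funS measurableT _ _ => //.
apply/measurable_fun_tnthP => m.
have mf : measurable_fun setT (fk k \_ (S k)).
  have mS := closed_measurable (@S_closed k).
  by apply/(measurable_restrictT (fk k) mS); exact: fk_measurable.
have ma : measurable_fun setT (amplitude k).
  rewrite (_ : amplitude k = Num.sqrt \o
    (fun s => P / Dm * ((fk k \_ (S k)) s - lower k)))//.
  apply: measurableT_comp.
    apply: continuous_measurable_fun; exact: sqrt_continuous.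
  by apply: measurable_funM => //; exact: measurable_funB.
apply: measurable_complexP.
  rewrite (_ : (fun w => _) = fun p : R * M.-tuple R =>
      amplitude k p.1 * tnth p.2 m).
    apply: measurable_funM; first exact: (measurableT_comp ma measurable_fst).
    exact: (measurableT_comp (measurable_tnth m) measurable_snd).
  by apply/funext => p /=; rewrite tnth_mktuple.
rewrite (_ : (fun w => _) = cst 0)//.
by apply/funext => p /=; rewrite tnth_mktuple.
Qed.

Lemma amplitude_sqr_bound k s : S k s -> amplitude k s ^+ 2 <= P.
Proof.
move=> Ss; have /andP[d0 ds] := spread_bound fk_bounded Ss.
have sm := spread_le_max S fk k; have m0 := max_spread_ge0 S fk.
rewrite -/Dm in sm m0; rewrite /amplitude patchE mem_set//=.
rewrite sqr_sqrtr; last by rewrite mulr_ge0// divr_ge0// ltW.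
have [->|Dn] := eqVneq Dm 0; first by rewrite invr0 mulr0 mul0r ltW.
have Dp : 0 < Dm by rewrite lt_neqAle eq_sym Dn.
rewrite mulrAC ler_pdivrMr// ler_wpM2l// ?(ltW P_gt0)//.
by apply: le_trans sm.
Qed.

Let encoder_power k m s i : S k s ->
  `|encoder k m s (rademacher_sign k m i)| ^+ 2 <= real_complex R P.
Proof.
move=> Ss; rewrite -add_Re2_Im2 lecR /= expr0n addr0 exprMn.
by rewrite /sign rademacher_sqr mulr1; exact: amplitude_sqr_bound.
Qed.

Let decoder_measurable : measurable_fun setT decoder.
Proof.
apply: measurableT_comp => //; apply: measurable_funD => //.
apply: measurable_funM => //; apply: measurable_funB => //.
apply: measurable_sum => b; apply: measurable_funX.
rewrite /real_coord; case: (odd b).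
  exact: (measurableT_comp measurable_Im (measurable_tnth _)).
exact: (measurableT_comp measurable_Re (measurable_tnth _)).
Qed.

Definition energy_scheme : dfa_scheme M S P :=
  @Build_dfa_scheme R K M S P _ _ pattern_law rademacher_sign encoder decoder
    encoder_measurable encoder_power decoder_measurable.

Lemma estimate_energy_scheme (T : Type) (H : 'I_K -> 'I_M -> T -> R[i])
    (N : 'I_M -> T -> R[i]) (s : K.-tuple R) (w : T) (i : nat) :
  scheme_estimate (sch := energy_scheme) H N s (w, i)
    = decode (estimated_sum (\sum_b (\sum_k
        rademacher (nth_pattern i (half_ord b)) k * amplitude k (tnth s k)
          * real_coord (fun m => H k m w) b
        + real_coord (fun m => N m w) b) ^+ 2)).
Proof.
rewrite /scheme_estimate /=; congr decode; congr estimated_sum.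
apply: eq_bigr => b _; congr (_ ^+ 2).
transitivity (real_coord (fun m => tnth (channel_output (fun k m => H k m w)
    (fun m => N m w) (fun k m => real_complex R (amplitude k (tnth s k)
      * rademacher (nth_pattern i m) k))) m) b); first by [].
rewrite (real_coord_channel_output _ _
  (fun k m => amplitude k (tnth s k) * rademacher (nth_pattern i m) k)).
by congr (_ + _); apply: eq_bigr => k _; rewrite (mulrC (amplitude _ _)).
Qed.

End dfa_scheme_construction.

(** * Means and variances of linear statistics *)

Section linear_statistics.
Context d (T : measurableType d) (R : realType) (Pr : probability T R).
Context (n : nat) (X : 'I_n -> {RV Pr >-> R}).
Hypothesis X_integrable : forall j, Pr.-integrable setT (EFin \o X j).

(** Entries of the driving vector may have nonzero mean; this lets them be centred without changing
    fading or noise. *)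
Lemma mean_linear_eq0 (a : 'I_n -> R) (Z : T -> R) :
  (forall w, Z w = \sum_j a j * X j w) -> ('E_Pr[Z] = 0)%E ->
  \sum_j a j * fine 'E_Pr[X j]%E = 0.
Proof.
move=> ZE EZ; have : (\int[Pr]_w (Z w)%:E = 0)%E by rewrite -EZ unlock.
have -> : (\int[Pr]_w (Z w)%:E = \int[Pr]_w (\sum_j (a j)%:E * (X j w)%:E))%E.
  by apply: eq_integral => w _; rewrite ZE -sumEFin.
rewrite integral_sum//; last first.
  by move=> j; exact: (integrableZl measurableT (a j) (X_integrable j)).
have E j : (\int[Pr]_w ((a j)%:E * (X j w)%:E) = (a j * fine 'E_Pr[X j])%:E)%E.
  rewrite (integralZl measurableT (X_integrable j)) EFinM unlock fineK//.
  exact: integrable_fin_num (X_integrable j).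
under eq_bigr do rewrite E.
by rewrite sumEFin => H; exact: EFin_inj H.
Qed.

End linear_statistics.

Lemma integral_sqr_variance d (T : measurableType d) (R : realType)
    (Pr : probability T R) (Z : T -> R) :
  ('E_Pr[Z] = 0)%E -> ('V_Pr[Z] = 1)%E -> (\int[Pr]_w (Z w ^+ 2)%:E = 1)%E.
Proof.
rewrite /variance [in covariance _ _ _]unlock => -> <-.
rewrite unlock; apply: eq_integral => w _.
by rewrite (_ : ((Z \- cst 0) * _) w = (Z w - 0) * (Z w - 0))// subr0 expr2.
Qed.

Lemma sum_sign_patterns (R : realType) K M (F : @sign_patterns K M -> \bar R) :
  \sum_(i < #|{: @sign_patterns K M}|.-1.+1) F (nth_pattern i) = \sum_u F u.
Proof.
have U0 : (0 < #|{: @sign_patterns K M}|)%N.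
  by apply/card_gt0P; exists [ffun=> [ffun=> false]].
rewrite prednK//.
rewrite -[RHS]big_enum /= (big_nth [ffun=> [ffun=> false]]) big_mkord.
by rewrite -cardE.
Qed.

(** * Assembly of the tail bound *)

Theorem theorem1 (R : realType) (K M : nat) (K_gt0 : (0 < K)%N)
  (M_gt0 : (0 < M)%N) (P : R) (P_gt0 : 0 < P)
  (S : 'I_K -> set R) (S_closed : forall k, closed (S k))
  (f : K.-tuple R -> R) (fk : 'I_K -> R -> R) (D0 : set R) (F0 : R -> R)
  (f_mon : mon_representation S f fk D0 F0)
  (Phi : R -> R) (f_Phi : increment_majorant D0 F0 Phi)
  (d : measure_display) (T : measurableType d) (Pr : probability T R)
  (H : 'I_K -> 'I_M -> {RV Pr >-> R[i]}) (N : 'I_M -> {RV Pr >-> R[i]})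
  (HN_channel : fading_channel H N)
  (A : 'M[R]_(2 * M * K, 2 * M * K + 2 * M))
  (B : 'M[R]_(2 * M, 2 * M * K + 2 * M))
  (HN_correlated : correlated_as A B H N)
  (Ai : 'M[R]_(2 * M * K, 2 * M * K + 2 * M))
  (Ai_uncorrelated : user_uncorrelated Ai)
  (eta : R) (Ai_approx : operator_norm ((A + Ai) *m (A - Ai)^T) <= eta) :
  let Db := total_spread S fk in
  let Dm := max_spread S fk in
  let L := (Num.sqrt Db * operator_norm A
            + Num.sqrt (Dm / P) * operator_norm B) ^+ 2 in
  let F := L * (Num.sqrt (Db / M%:R) * frobenius_norm A
                + Num.sqrt (Dm / (P * M%:R)) * frobenius_norm B) ^+ 2 in
  let D := (4 * Num.sqrt (2 * M%:R) * Db * eta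
            + 4 * (Dm / Num.sqrt (P * M%:R)) * frobenius_norm (A *m B^T)) ^+ 2
  in
  exists sch : dfa_scheme M S P,
    forall (s : K.-tuple R) (eps : R),
      box S s -> 0 < eps -> (Phi @` [set x : R | 0 <= x]) eps ->
      let t := majorant_inv Phi eps in
      ((Pr \x rnd_law sch)
         [set w | (eps <= `|scheme_estimate H N s w - f s|)%R]
       <= 2%:E * expeR (- ((M%:R * t ^+ 2)%:E
                           / (16 * F + D + 4 * t * L)%:E))
          + 2%:E * expeR (- ((M%:R * t ^+ 2)%:E
                             / (256 * F + 32 * t * L)%:E)))%E.
Proof.
move=> Db Dm L F D.
have [X [X_indep X_sg HX NX]] := HN_correlated.
set n := (2 * M * K + 2 * M)%N in A B HN_correlated Ai Ai_uncorrelated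
  Ai_approx L F D X X_indep X_sg HX NX *.
pose mu j := fine ('E_Pr[X j])%E.
have X_int j : Pr.-integrable setT (EFin \o X j) by exact: subgaussian_integrable.
have mY j : measurable_fun setT (fun w => X j w - mu j) by exact: measurable_funB.
pose Y j : {RV Pr >-> R} := mfun_Sub (mem_set (mY j)).
have Y_indep : mutually_independent Pr Y by exact: mutually_independent_shift.
have Y_mgf j : mgf_subgaussian Pr (Y j) by exact: subgaussian_norm_mgf.
pose Hr k b w := real_coord (fun m => H k m w) b.
pose Nr b w := real_coord (fun m => N m w) b.
have HrX k b w : Hr k b w = \sum_j A (mxvec_index b k) j * X j w.
  rewrite /Hr -(fading_vectorE (fun k m => H k m w)) HX mxE.
  by apply: eq_bigr => j _; rewrite mxE.
have NrX b w : Nr b w = \sum_j B b j * X j w.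
  have := congr1 (fun v : 'cV_ _ => v b 0) (NX w); rewrite /Nr !mxE => ->.
  by apply: eq_bigr => j _; rewrite mxE.
have EH k b : ('E_Pr[Hr k b] = 0)%E.
  rewrite /Hr /real_coord; case: (odd b).
    exact: (fading_mean_Im HN_channel).
  exact: (fading_mean_Re HN_channel).
have EN b : ('E_Pr[Nr b] = 0)%E.
  rewrite /Nr /real_coord; case: (odd b).
    exact: (noise_mean_Im HN_channel).
  exact: (noise_mean_Re HN_channel).
have VH k b : ('V_Pr[Hr k b] = 1)%E.
  rewrite /Hr /real_coord; case: (odd b).
    exact: (fading_variance_Im HN_channel).
  exact: (fading_variance_Re HN_channel).
have HrY k b w : Hr k b w = \sum_j A (mxvec_index b k) j * Y j w.
  under eq_bigr do rewrite mulrBr.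
  by rewrite sumrB -HrX (mean_linear_eq0 X_int (HrX k b) (EH k b)) subr0.
have NrY b w : Nr b w = \sum_j B b j * Y j w.
  under eq_bigr do rewrite mulrBr.
  by rewrite sumrB -NrX (mean_linear_eq0 X_int (NrX b) (EN b)) subr0.
(* Unit variance of the fading fixes the weighted norm of every row of [A]. *)
have A_unit k b : \sum_j second_moment (Y j) * A (mxvec_index b k) j ^+ 2 = 1.
  apply: (second_moment_linear Y_indep Y_mgf).
  under eq_integral do rewrite -HrY.
  exact: integral_sqr_variance.
(* The mean noise energy. The decoder may subtract it, as the scheme may depend on the law of the
   channel. *)
pose cN := \sum_b \sum_j second_moment (Y j) * B b j ^+ 2.
pose ext := increment_extension D0 F0 Phi.
have mext : measurable_fun setT ext by exact: measurable_increment_extension.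
have fk_bd := mon_inner_bounded f_mon.
exists (energy_scheme cN P_gt0 S_closed (mon_inner_measurable f_mon) fk_bd mext).
move=> s eps Ss eps0 eps_im; lazy zeta; set t := majorant_inv Phi eps.
have t0 : 0 <= t.
  have Phi_inj : {in [set x : R | 0 <= x] &, injective Phi}.
    move=> x1 x2; rewrite !inE/= => x10 x20 e.
    case: (ltgtP x1 x2) => [x12|x21|//]; exfalso.
    - by have := majorant_incr f_Phi x10 x12; rewrite e ltxx.
    - by have := majorant_incr f_Phi x20 x21; rewrite e ltxx.
  have : (pinv [set x : R | 0 <= x] Phi @` (Phi @` [set x | 0 <= x])) t by exists eps.
  by rewrite injpinv_image.
have Phit : Phi t = eps by apply: pinvK; rewrite inE.
have tp : 0 < t.
  rewrite lt_neqAle t0 andbT eq_sym; apply/eqP => tE.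
  by move: Phit eps0; rewrite tE (majorant0 f_Phi) => <-; rewrite ltxx.
pose lower k := inf (fk k @` S k).
pose dl k := fk k (tnth s k) - lower k.
have dl_bd k : 0 <= dl k <= spread S fk k by exact: spread_bound.
have Dm0 : 0 <= Dm by exact: max_spread_ge0.
have dlDm k : dl k <= Dm.
  by have /andP[_ /le_trans] := dl_bd k; apply; exact: spread_le_max.
have dl_sum : \sum_k dl k <= Db.
  by apply: ler_sum => k _; have /andP[] := dl_bd k.
pose y := \sum_k fk k (tnth s k).
have Dy : D0 y.
  by have := @mon_domain_sub _ _ _ _ _ _ _ f_mon; apply; exists s.
have fE : f s = F0 y by exact: (mon_repr f_mon Ss).
pose sch : dfa_scheme M S P :=
  energy_scheme cN P_gt0 S_closed (mon_inner_measurable f_mon) fk_bd mext.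
rewrite -/sch.
pose a k := amplitude P S fk k (tnth s k).
pose W (u : @sign_patterns K M) b j :=
  mixture A B (fun b k => rademacher (u (half_ord b)) k * a k) 1 b j.
pose en (u : @sign_patterns K M) w := \sum_b (\sum_j W u b j * Y j w) ^+ 2.
have aE k : a k = Num.sqrt (P / Dm * dl k).
  by rewrite /a /amplitude patchE mem_set//; exact: Ss.
have recvE (u : @sign_patterns K M) b w :
    \sum_k rademacher (u (half_ord b)) k * a k * Hr k b w + Nr b w
      = \sum_j W u b j * Y j w.
  pose x : 'cV[R]_n := \col_j Y j w.
  transitivity (\sum_j W u b j * x j 0); last first.
    by apply: eq_bigr => j _; rewrite mxE.
  rewrite mixture_mulmx mul1r; congr (_ + _); last first.
    by rewrite NrY mxE; apply: eq_bigr => j _; rewrite mxE.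
  apply: eq_bigr => k _; congr (_ * _).
  by rewrite HrY mxE; apply: eq_bigr => j _; rewrite mxE.
have enE i w : \sum_b (\sum_k rademacher (nth_pattern i (half_ord b)) k * a k
    * Hr k b w + Nr b w) ^+ 2 = en (nth_pattern i) w.
  by apply: eq_bigr => b _; rewrite recvE.
have estE w i : scheme_estimate (sch := sch) H N s (w, i) =
    ext (estimated_sum (M := M) P S fk cN (en (nth_pattern i) w)).
  rewrite -enE.
  exact: estimate_energy_scheme.
have men u : measurable_fun setT (en u).
  apply: measurable_sum => b; apply: measurable_funX; apply: measurable_sum => j.
  exact: measurable_funM.
pose Z u w := estimated_sum (M := M) P S fk cN (en u w).
have mZ u : measurable_fun setT (Z u).
  apply: measurable_funD => //; apply: measurable_funM => //.
  exact: measurable_funB.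
have mE u : measurable [set w | eps <= `|ext (Z u w) - f s|].
  have mf : measurable_fun setT (fun w => `|ext (Z u w) - f s|).
    apply: measurableT_comp => //; apply: measurable_funB => //.
    exact: measurableT_comp.
  have := mf measurableT _ (measurable_itv `[eps, +oo[).
  rewrite setTI; congr measurable.
  by apply/seteqP; split => w /=; rewrite in_itv/= andbT.
have EZ u w : eps <= `|ext (Z u w) - f s| -> t <= 2 * `|Z u w - y|.
  move=> epsE; rewrite leNgt; apply/negP => /(increment_extension_lt f_Phi Dy).
  by rewrite Phit -fE ltNge epsE.
set E := [set w | _].
have E_section i : ysection E i = [set w | eps <= `|ext (Z (nth_pattern i) w) - f s|].
  rewrite ysectionE; apply/funext => w.
  exact: (congr1 (fun e => is_true (eps <= `|e - f s|)) (estE w i)).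
have mEprod : measurable E.
  apply: measurable_prod_nat => i.
  rewrite (_ : [set w | _] = ysection E i); first by rewrite E_section.
  by rewrite ysectionE.
have e2_ge0 r : (0 <= 2%:E * expeR r)%E by apply: mule_ge0; rewrite ?lee_fin ?expeR_ge0.
apply: (@le_trans _ _ (2%:E * expeR (- ((M%:R * t ^+ 2)%:E
    / (256 * F + 32 * t * L)%:E)))%E); last by rewrite leeDr ?e2_ge0.
(* The probability becomes the average over sign patterns of conditional probabilities. *)
rewrite (product_uniform_nat _ Pr mEprod).
under eq_bigr do rewrite E_section.
rewrite (sum_sign_patterns (fun u => Pr [set w | eps <= `|ext (Z u w) - f s|])).
have NU : #|{: @sign_patterns K M}|.-1.+1 = #|{ffun 'I_M -> {ffun 'I_K -> bool}}|.
  rewrite prednK//; apply/card_gt0P.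
  by exists [ffun=> [ffun=> false]].
rewrite NU.
have NU0 : (#|{ffun 'I_M -> {ffun 'I_K -> bool}}|%:R != 0 :> R).
  by rewrite -NU pnatr_eq0.
have M0 : 0 < M%:R :> R by rewrite ltr0n.
(* If [Dm = 0] every [fk k] is constant on [S k], the estimated sum is exact and the error event is
   empty. *)
have [Dm00|Dmn] := eqVneq Dm 0.
  rewrite big1 ?mule0// => u _.
  rewrite (_ : [set w | _] = set0) ?measure0//.
  apply/seteqP; split => // w /EZ; rewrite leNgt => /negP; apply.
  have -> : Z u w = y.
    rewrite /Z /estimated_sum -/Dm Dm00 !mul0r add0r; apply: eq_bigr => k _.
    have : dl k = 0.
      by apply/eqP; rewrite eq_le -{1}Dm00 dlDm; have /andP[] := dl_bd k.
    by rewrite /dl /lower => /subr0_eq.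
  by rewrite subrr normr0 mulr0.
have Dmp : 0 < Dm by rewrite lt_neqAle eq_sym Dmn.
have spread0 k : 0 <= spread S fk k by have /andP[/le_trans] := dl_bd k; apply.
have Dbp : 0 < Db.
  apply: lt_le_trans Dmp _; apply: bigmax_le; first exact: sumr_ge0.
  by move=> k _; rewrite /Db /total_spread (bigD1 k)//= lerDl sumr_ge0.
(* Undoes the power scaling: [r * a k] is the square root of [dl k]. Thus [v] has weights of squared
   sum at most [Db] and noise factor [sqrt (Dm / P)], the two terms of [L]. *)
pose r := Num.sqrt (Dm / P).
have r0 : 0 <= r by exact: sqrtr_ge0.
have r2 : r ^+ 2 = Dm / P by rewrite sqr_sqrtr// divr_ge0// ltW.
have ra k : r * a k = Num.sqrt (dl k).
  rewrite aE -sqrtrM; last by rewrite divr_ge0// ltW.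
  by congr Num.sqrt; field; rewrite Dmn gt_eqF.
have sq_dl k : Num.sqrt (dl k) ^+ 2 = dl k.
  by rewrite sqr_sqrtr//; have /andP[] := dl_bd k.
pose v b (c : {ffun 'I_K -> bool}) j :=
  mixture A B (fun _ k => rademacher c k * Num.sqrt (dl k)) r b j.
have vW (u : @sign_patterns K M) b j : v b (u (half_ord b)) j = r * W u b j.
  rewrite /v /W /mixture mul1r mulrDr; congr (_ + _).
  rewrite mulr_sumr; apply: eq_bigr => k _; rewrite -ra; ring.
have L0 : 0 <= L by exact: sqr_ge0.
pose g := (Num.sqrt Db * frobenius_norm A + r * frobenius_norm B) ^+ 2.
have q_le (u : @sign_patterns K M) (b : 'I_(2 * M)) :
    \sum_k (rademacher (u (half_ord b)) k * Num.sqrt (dl k)) ^+ 2 <= Db.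
  apply: le_trans dl_sum; apply: ler_sum => k _.
  by rewrite exprMn rademacher_sqr mul1r sq_dl.
have V_bd (u : @sign_patterns K M) (x : 'I_n -> R) :
    \sum_b (\sum_j v b (u (half_ord b)) j * x j) ^+ 2 <= L * \sum_j x j ^+ 2.
  exact: (mixture_operator_le A B r0 (q_le u)).
have V_frob (u : @sign_patterns K M) :
    \sum_b \sum_j v b (u (half_ord b)) j ^+ 2 <= g.
  exact: (mixture_frobenius_le A B r0 (q_le u)).
pose ET := 2 * M%:R * \sum_k dl k + Dm / P * cN.
have C0 : (0 < #|{ffun 'I_K -> bool}|)%N.
  by apply/card_gt0P; exists [ffun=> false].
(* For each driving coordinate the sign average leaves only squares; [A_unit] then turns the
   weighted squares of the row of user [k] into [dl k]. *)
have ET_def : #|{ffun 'I_K -> bool}|%:R * ET =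
    \sum_b \sum_c \sum_j second_moment (Y j) * v b c j ^+ 2.
  have vE b c j : v b c j = r * B b j + \sum_k rademacher c k *
      (Num.sqrt (dl k) * A (mxvec_index b k) j).
    by rewrite /v /mixture addrC; congr (_ + _); apply: eq_bigr => k _; ring.
  transitivity (\sum_b #|{ffun 'I_K -> bool}|%:R * (\sum_k dl k + Dm / P *
      \sum_j second_moment (Y j) * B b j ^+ 2)).
    rewrite -mulr_sumr big_split/= sumr_const card_ord -mulr_sumr -/cN.
    by rewrite /ET; congr (_ * (_ + _)); rewrite -[RHS]mulr_natl natrM.
  apply: eq_bigr => b _; rewrite exchange_big/=.
  transitivity (\sum_j #|{ffun 'I_K -> bool}|%:R * (second_moment (Y j) *
      ((r * B b j) ^+ 2 + \sum_k (Num.sqrt (dl k) * A (mxvec_index b k) j) ^+ 2))).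
    rewrite -mulr_sumr; congr (_ * _).
    under [RHS]eq_bigr do rewrite mulrDr.
    rewrite [RHS]big_split/= [RHS]addrC; congr (_ + _); last first.
      by rewrite mulr_sumr; apply: eq_bigr => j _; rewrite exprMn r2; ring.
    under [RHS]eq_bigr do rewrite mulr_sumr.
    rewrite exchange_big/=; apply: eq_bigr => k _.
    rewrite -[LHS]mulr1 -(A_unit k b) mulr_sumr; apply: eq_bigr => j _.
    by rewrite exprMn sq_dl; ring.
  apply: eq_bigr => j _; rewrite -mulr_sumr mulrCA; congr (_ * _).
  by rewrite -sum_rademacher_sqr; apply: eq_bigr => c _; rewrite vE.
(* A row of [A] has weighted norm 1 with weights at most 8/3, so the operator norm cannot vanish. *)
have Lp : 0 < L.
  have opA := operator_norm_ge0 A; have opB := operator_norm_ge0 B.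
  have opA1 : 3 / 8 <= operator_norm A ^+ 2.
    have M2 : (0 < 2 * M)%N by rewrite muln_gt0.
    have Ab := sum_sqr_row_le_operator_norm A
      (mxvec_index (Ordinal M2) (Ordinal K_gt0)).
    have : 1 <= 8 / 3 * \sum_j A (mxvec_index (Ordinal M2) (Ordinal K_gt0)) j ^+ 2.
      rewrite -[leLHS](A_unit (Ordinal K_gt0) (Ordinal M2)) mulr_sumr.
      by apply: ler_sum => j _; rewrite ler_wpM2r ?sqr_ge0// second_moment_le.
    lra.
  have opAp : 0 < operator_norm A.
    rewrite lt_neqAle opA andbT eq_sym; apply/eqP => A0.
    by move: opA1; rewrite A0 expr0n/=; lra.
  rewrite exprn_gt0// ltr_wpDr ?mulr_ge0 ?sqrtr_ge0//.
  by rewrite mulr_gt0// sqrtr_gt0.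
(* The rescaled energy deviates by [2 * M] times the error of the estimated sum, which is at least
   [t / 2]. *)
have Mt0 : 0 < M%:R * t by rewrite mulr_gt0.
have := randomized_energy_tail Y_indep Y_mgf (@card_half_ord M) C0 L0 V_bd V_frob
  ET_def Mt0 Lp.
set tail := expR _ => tail_bd.
apply: (@le_trans _ _ (2 * tail)%:E); last first.
  (* The factors 1/M inside [F] give [L * g = M * F], and one [M] cancels against the square of the
     deviation [M * t]. *)
  have LgMF : L * g = M%:R * F.
    have sM : Num.sqrt M%:R ^+ 2 = M%:R :> R by rewrite sqr_sqrtr// ltW.
    rewrite /F (mulrCA M%:R); congr (_ * _).
    rewrite sqrtrM; last by rewrite ltW.
    rewrite (_ : Dm / (P * M%:R) = (Dm / P) / M%:R); last first.
      by field; rewrite !gt_eqF.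
    rewrite (sqrtrM (M%:R^-1) (_ : 0 <= Dm / P)); last by rewrite divr_ge0// ltW.
    have q0 : Num.sqrt M%:R != 0 :> R by rewrite sqrtr_eq0 -ltNge.
    rewrite -/r sqrtrV ?ltW//; move: (Num.sqrt M%:R) sM q0 => q <- q0.
    by rewrite /g; field.
  have den0 : 0 < 256 * F + 32 * t * L.
    have : 0 < t * L by rewrite mulr_gt0.
    have : 0 <= F by rewrite /F mulr_ge0// sqr_ge0.
    lra.
  have -> : ((M%:R * t ^+ 2)%:E / (256 * F + 32 * t * L)%:E =
      (M%:R * t ^+ 2 / (256 * F + 32 * t * L))%:E)%E by rewrite inver gt_eqF.
  rewrite lee_fin /tail.
  rewrite le_eqVlt; apply/predU1P; left; congr (_ * expR (- _)).
  rewrite LgMF; field; rewrite !gt_eqF//.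
  have -> : 256 * (M%:R * F) + 32 * (M%:R * t) * L = M%:R * (256 * F + 32 * t * L).
    by ring.
  by rewrite mulr_gt0.
apply: (@le_trans _ _ ((#|{ffun 'I_M -> {ffun 'I_K -> bool}}|%:R^-1)%:E *
    (#|{ffun 'I_M -> {ffun 'I_K -> bool}}|%:R * (2 * tail))%:E)%E); last first.
  by rewrite -EFinM mulKf.
apply: lee_wpmul2l; first by rewrite lee_fin invr_ge0 ler0n.
apply: le_trans tail_bd; apply: lee_sum => u _.
have enV w : \sum_b (\sum_j v b (u (half_ord b)) j * Y j w) ^+ 2 = Dm / P * en u w.
  rewrite /en mulr_sumr; apply: eq_bigr => b _.
  rewrite -r2 -exprMn mulr_sumr; congr (_ ^+ 2); apply: eq_bigr => j _.
  by rewrite vW mulrA.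
apply: le_measure; rewrite ?inE//.
  have mf : measurable_fun setT
      (fun w => `|\sum_b (\sum_j v b (u (half_ord b)) j * Y j w) ^+ 2 - ET|).
    apply: measurableT_comp => //; apply: measurable_funB => //.
    apply: measurable_sum => b; apply: measurable_funX; apply: measurable_sum => j.
    exact: measurable_funM.
  have := mf measurableT _ (measurable_itv `[M%:R * t, +oo[).
  rewrite setTI; congr measurable.
  by apply/seteqP; split => w /=; rewrite in_itv/= andbT.
move=> w /EZ tZ /=; rewrite enV.
have -> : Dm / P * en u w - ET = 2 * M%:R * (Z u w - y).
  have -> : y = \sum_k lower k + \sum_k dl k.
    by rewrite -big_split/=; apply: eq_bigr => k _; rewrite addrC subrK.
  rewrite /Z /estimated_sum /ET -/Dm -/(lower _).
  by field; rewrite !gt_eqF.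
rewrite normrM ger0_norm; last by rewrite mulr_ge0// ler0n.
by rewrite (mulrC 2) -mulrA ler_wpM2l// ler0n.
Qed.
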